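(* Let $h:\mathbb{N}\to(0,\infty)$ be a growth function, $H_r=\ell^2_{h^r}$ for $r\in\mathbb{R}$, and let $A\in\mathcal{F}_h^*$ be an invertible weak Hessian of Floer type. Then there exists an open neighborhood $\mathcal{U}_A$ of $A$ in $\mathcal{F}_h^*$ such that the spectral projection selector maps $$\Pi_\pm:\mathcal{U}_A\to\mathcal{L}(H_{\frac12})\cap\mathcal{L}(H_{\frac32}),\qquad B\mapsto\Pi_\pm(B),$$ are continuous.
   Context: $\mathbb{N}=\{1,2,\dots\}$. A growth function is a monotone (nondecreasing) unbounded function $h:\mathbb{N}\to(0,\infty)$. For $r\in\mathbb{R}$, $H_r:=\ell^2_{h^r}$ is the Hilbert space of real sequences $x=(x_\nu)_{\nu\in\mathbb{N}}$ with $\sum_\nu h(\nu)^r x_\nu^2<\infty$, with inner product $\langle x,y\rangle_r=\sum_\nu h(\nu)^r x_\nu y_\nu$; for $s<r$ the inclusion $H_r\subset H_s$ is compact and dense. The space of weak Hessians $\mathcal{H}_h\subset\mathcal{L}(H_1,H_0)\cap\mathcal{L}(H_2,H_1)$ consists of all bounded linear maps $A:H_1\to H_0$ which are Fredholm of index zero, $H_0$-symmetric ($\langle Ax,y\rangle_0=\langle x,Ay\rangle_0$ for all $x,y\in H_1$), and which restrict to a bounded linear map $H_2\to H_1$ that is also Fredholm of index zero. It carries the subspace topology from the norm $\max\{\|\cdot\|_{\mathcal{L}(H_1,H_0)},\|\cdot\|_{\mathcal{L}(H_2,H_1)}\}$. The spectrum of $A\in\mathcal{H}_h$ consists of discrete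 real eigenvalues of finite multiplicity, and there is an orthonormal basis of $H_0$ of eigenvectors of $A$ in $H_1$. $\mathcal{F}_h\subset\mathcal{H}_h$ is the subset of Floer type weak Hessians (infinitely many positive and infinitely many negative eigenvalues), and $\mathcal{F}_h^*\subset\mathcal{F}_h$ is the subset of invertible ones. For $B\in\mathcal{F}_h^*$, $\Pi_+(B)$ (resp. $\Pi_-(B)$) is the $H_0$-orthogonal projection onto the closed span of the eigenvectors of $B$ with positive (resp. negative) eigenvalues. It restricts to bounded projections on $H_1$ and $H_2$, hence (by interpolation) on $H_{1/2}$ and $H_{3/2}$, and it is regarded as an element of $\mathcal{L}(H_{1/2})\cap\mathcal{L}(H_{3/2})$, which carries the norm $\max\{\|\cdot\|_{\mathcal{L}(H_{1/2})},\|\cdot\|_{\mathcal{L}(H_{3/2})}\}$. *)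

(* Defs.v *)
From HB Require Import structures.
From mathcomp Require Import all_boot all_order all_algebra.
From mathcomp Require Import all_classical all_reals all_analysis.
From mathcomp Require Import ring.
Set Implicit Arguments. Unset Strict Implicit. Unset Printing Implicit Defensive.
Import Order.TTheory GRing.Theory Num.Theory.
Import numFieldNormedType.Exports.
Local Open Scope classical_set_scope.
Local Open Scope ring_scope.

(* The index set {1, 2, ...} is reindexed by [nat]: [h n] and [x n] stand for
   the values at n + 1. *)
Record growth (R : realType) := Growth {
  growth_fun :> nat -> R;
  growth_gt0 : forall n, 0 < growth_fun n;
  growth_mono : forall m n, (m <= n)%N -> growth_fun m <= growth_fun n;
  growth_unbounded : forall M, exists n, M < growth_fun n }.

Section WeightedSpace.
Context {R : realType} (h : growth R) (r : R).

Definition ip (x y : nat -> R) : R :=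
  limn (series (fun n => h n `^ r * x n * y n)).

Definition wsummable : {pred nat -> R} :=
  [pred x : nat -> R | `[< cvgn (series (fun n => h n `^ r * x n ^+ 2)) >]].

Let w_ge0 n : 0 <= h n `^ r. Proof. exact: powR_ge0. Qed.

Lemma wsummableP x :
  x \in wsummable <-> cvgn (series (fun n => h n `^ r * x n ^+ 2)).
Proof. by split=> [/asboolP|?]; last exact/asboolP. Qed.

(* Young's inequality with parameter t; the triangle inequality is obtained
   by optimizing t. *)
Let young (t a b : R) : 0 < t ->
  (a + b) ^+ 2 <= (1 + t) * a ^+ 2 + (1 + t^-1) * b ^+ 2.
Proof.
move=> t0; rewrite -subr_ge0.
have -> : (1 + t) * a ^+ 2 + (1 + t^-1) * b ^+ 2 - (a + b) ^+ 2
          = t * (a - t^-1 * b) ^+ 2.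
  have tn0 : t != 0 by rewrite gt_eqF.
  by field.
by apply: mulr_ge0; [exact: ltW|exact: sqr_ge0].
Qed.

Lemma series_young t x y : 0 < t ->
  x \in wsummable -> y \in wsummable ->
  x + y \in wsummable /\ ip (x + y) (x + y) <= (1 + t) * ip x x + (1 + t^-1) * ip y y.
Proof.
move=> t0 /wsummableP cx /wsummableP cy.
have ipE (z : nat -> R) : ip z z = limn (series (fun n => h n `^ r * z n ^+ 2)).
  by congr (limn (series _)); apply/funext => n; rewrite expr2 mulrA.
set wx := (fun n => h n `^ r * x n ^+ 2) in cx *.
set wy := (fun n => h n `^ r * y n ^+ 2) in cy *.
pose u := (1 + t) *: wx + (1 + t^-1) *: wy.
have c1 := is_cvg_seriesZ (k := 1 + t) cx.
have c2 := is_cvg_seriesZ (k := 1 + t^-1) cy.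
have cu : cvgn (series u) := is_cvg_seriesD c1 c2.
have le n : h n `^ r * (x + y) n ^+ 2 <= u n.
  have -> : u n = (1 + t) * (h n `^ r * x n ^+ 2)
                  + (1 + t^-1) * (h n `^ r * y n ^+ 2) by [].
  rewrite (mulrCA (1 + t)) (mulrCA (1 + t^-1)) -mulrDr ler_wpM2l//.
  exact: young.
have cxy : cvgn (series (fun n => h n `^ r * (x + y) n ^+ 2)).
  apply: (series_le_cvg _ _ le cu) => n; first by rewrite mulr_ge0 ?sqr_ge0.
  by apply: le_trans (le n); rewrite mulr_ge0 ?sqr_ge0.
split; first exact/wsummableP.
rewrite !ipE; apply: (@le_trans _ _ (limn (series u))).
  by apply: ler_lim => //; near=> n; apply: ler_sum => i _.
by rewrite /u lim_seriesD// !lim_seriesZ.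
Unshelve. all: by end_near. Qed.

Lemma series_scale a x : x \in wsummable ->
  a *: x \in wsummable /\ ip (a *: x) (a *: x) = a ^+ 2 * ip x x.
Proof.
move=> /wsummableP cx.
have ipE (z : nat -> R) : ip z z = limn (series (fun n => h n `^ r * z n ^+ 2)).
  by congr (limn (series _)); apply/funext => n; rewrite expr2 mulrA.
have su : (fun n => h n `^ r * (a *: x) n ^+ 2)
          = a ^+ 2 *: (fun n => h n `^ r * x n ^+ 2).
  by apply/funext => n; rewrite !fctE exprMn mulrCA.
split; first by apply/wsummableP; rewrite su; exact: is_cvg_seriesZ.
by rewrite !ipE su lim_seriesZ.
Qed.

Lemma wsummable_submod_closed : submod_closed wsummable.
Proof.
split.
  apply/wsummableP.
  rewrite (_ : series _ = cst 0); first exact: is_cvg_cst.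
  by apply/funext => n; rewrite /series /= big1// => i _; rewrite expr0n mulr0.
move=> a x y sx sy; have [sax _] := series_scale a sx.
by have [] := series_young ltr01 sax sy.
Qed.

HB.instance Definition _ :=
  GRing.isSubmodClosed.Build R (nat -> R) wsummable wsummable_submod_closed.

Record Hsp := MkHsp { seq_of :> nat -> R; _ : seq_of \in wsummable }.

HB.instance Definition _ := [isSub of Hsp for seq_of].
HB.instance Definition _ := gen_eqMixin Hsp.
HB.instance Definition _ := gen_choiceMixin Hsp.
HB.instance Definition _ := [SubChoice_isSubLmodule of Hsp by <:].

Definition Hnorm (x : Hsp) : R := Num.sqrt (ip x x).

Lemma ip_ge0 (x : Hsp) : 0 <= ip x x.
Proof.
have /wsummableP cx := valP x.
apply: limr_ge.
  rewrite (_ : (fun n => _) = (fun n => h n `^ r * x n ^+ 2)) //.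
  by apply/funext => n; rewrite expr2 mulrA.
near=> n; apply: sumr_ge0 => i _; rewrite -mulrA mulr_ge0// -expr2.
exact: sqr_ge0.
Unshelve. all: by end_near. Qed.

Lemma Hnorm0_eq0 x : Hnorm x = 0 -> x = 0.
Proof.
move=> /eqP; rewrite sqrtr_eq0 => ip0.
apply/val_inj/funext => n /=.
have /wsummableP cx := valP x.
have ipE : ip x x = limn (series (fun n => h n `^ r * x n ^+ 2)).
  by congr (limn (series _)); apply/funext => k; rewrite expr2 mulrA.
have nd : nondecreasing_seq (series (fun n => h n `^ r * x n ^+ 2)).
  by apply: nondecreasing_series => k _ _; rewrite mulr_ge0 ?sqr_ge0.
have := nondecreasing_cvgn_le nd cx n.+1; rewrite -ipE => /le_trans/(_ ip0).
rewrite /series /= big_nat_recr//= => s0.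
have : h n `^ r * x n ^+ 2 <= 0.
  by apply: le_trans s0; rewrite lerDr sumr_ge0// => i _; rewrite mulr_ge0 ?sqr_ge0.
rewrite pmulr_rle0 ?powR_gt0 ?growth_gt0// => x0.
by apply/eqP; rewrite -sqrf_eq0 eq_le x0 sqr_ge0.
Qed.

Lemma HnormZ (a : R) x : Hnorm (a *: x) = `|a| * Hnorm x.
Proof.
have [_ e] := series_scale a (valP x).
by rewrite /Hnorm [ip _ _]e sqrtrM ?sqr_ge0// sqrtr_sqr.
Qed.

Lemma ler_HnormD x y : Hnorm (x + y) <= Hnorm x + Hnorm y.
Proof.
have n0 z : 0 <= Hnorm z by exact: sqrtr_ge0.
have [/Hnorm0_eq0->|x0] := eqVneq (Hnorm x) 0; first by rewrite add0r lerDr.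
have [/Hnorm0_eq0->|y0] := eqVneq (Hnorm y) 0; first by rewrite addr0 lerDl.
have xp : 0 < Hnorm x by rewrite lt_neqAle eq_sym x0 n0.
have yp : 0 < Hnorm y by rewrite lt_neqAle eq_sym y0 n0.
rewrite -ler_sqr ?nnegrE ?addr_ge0// {1}/Hnorm sqr_sqrtr ?ip_ge0//.
have t0 : 0 < Hnorm y / Hnorm x by rewrite divr_gt0.
have [_] := series_young t0 (valP x) (valP y); move/le_trans; apply.
rewrite -[ip (val x) _]sqr_sqrtr ?ip_ge0// -[ip (val y) _]sqr_sqrtr ?ip_ge0//.
rewrite -/(Hnorm x) -/(Hnorm y) le_eqVlt; apply/orP; left; apply/eqP.
by field; rewrite x0 y0.
Qed.

HB.instance Definition _ :=
  Lmodule_isNormed.Build R Hsp ler_HnormD HnormZ Hnorm0_eq0.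

End WeightedSpace.

Section BoundedOperators.
Context {R : realType} (E F : normedModType R).

Definition bounded_linear : {pred E -> F} :=
  [pred f : E -> F | `[< linear f /\ exists M, forall x, `|f x| <= M * `|x| >]].

Lemma bounded_linearP f : f \in bounded_linear <->
  linear f /\ exists M, forall x, `|f x| <= M * `|x|.
Proof. by split=> [/asboolP|?]; last exact/asboolP. Qed.

Lemma bounded_linear_submod_closed : submod_closed bounded_linear.
Proof.
split.
  apply/bounded_linearP; split; first by move=> a x y; rewrite /= scaler0 addr0.
  by exists 0 => x; rewrite /= normr0 mul0r.
move=> a f g /bounded_linearP[lf [M fM]] /bounded_linearP[lg [N gN]].
apply/bounded_linearP; split.
  move=> b x y; rewrite !fctE lf lg !scalerDr addrACA; congr (_ + _ + _).
  by rewrite !scalerA mulrC.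
exists (`|a| * M + N) => x; rewrite !fctE mulrDl.
by rewrite (le_trans (ler_normD _ _))// lerD// normrZ -mulrA ler_wpM2l.
Qed.

HB.instance Definition _ := GRing.isSubmodClosed.Build R (E -> F) bounded_linear
  bounded_linear_submod_closed.

Record bdop := MkBdop { bdop_fun :> E -> F; _ : bdop_fun \in bounded_linear }.

HB.instance Definition _ := [isSub of bdop for bdop_fun].
HB.instance Definition _ := gen_eqMixin bdop.
HB.instance Definition _ := gen_choiceMixin bdop.
HB.instance Definition _ := [SubChoice_isSubLmodule of bdop by <:].

Lemma bdop_linear (T : bdop) : linear T.
Proof. by have /bounded_linearP[] := valP T. Qed.

HB.instance Definition _ (T : bdop) :=
  GRing.isLinear.Build R E F *:%R T (bdop_linear T).

Definition opnorm (T : bdop) : R := sup [set `|T x| | x in [set x | `|x| <= 1]].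

Let has_sup_opnorm (T : bdop) : has_sup [set `|T x| | x in [set x | `|x| <= 1]].
Proof.
have /bounded_linearP[_ [M TM]] := valP T.
split; first by exists `|T 0|, 0 => //=; rewrite normr0.
exists `|M| => _ [x /= x1 <-]; rewrite (le_trans (TM x))//.
rewrite (le_trans (ler_norm _))// normrM normr_id.
by rewrite ler_piMr.
Qed.

Let opnorm_bound (T : bdop) x : `|x| <= 1 -> `|T x| <= opnorm T.
Proof.
by move=> x1; apply: ub_le_sup; [exact: (has_sup_opnorm T).2|exists x].
Qed.

Let opnorm_le (T : bdop) M : (forall x, `|x| <= 1 -> `|T x| <= M) -> opnorm T <= M.
Proof.
move=> TM; apply: ge_sup; first exact: (has_sup_opnorm T).1.
by move=> _ [x /= x1 <-]; exact: TM.
Qed.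

Lemma ler_opnormD S T : opnorm (S + T) <= opnorm S + opnorm T.
Proof.
apply: opnorm_le => x x1.
have -> : (S + T) x = S x + T x by [].
by rewrite (le_trans (ler_normD _ _))// lerD// opnorm_bound.
Qed.

Let opnormZ_le (a : R) T : opnorm (a *: T) <= `|a| * opnorm T.
Proof.
apply: opnorm_le => x x1.
have -> : (a *: T) x = a *: T x by [].
by rewrite normrZ ler_wpM2l// opnorm_bound.
Qed.

Lemma opnorm0_eq0 T : opnorm T = 0 -> T = 0.
Proof.
move=> T0; apply/val_inj/funext => x /=.
have [->|x0] := eqVneq x 0; first by rewrite linear0.
have nx : `|x| != 0 by rewrite normr_eq0.
have : `|T (`|x|^-1 *: x)| <= opnorm T.
  by apply: opnorm_bound; rewrite normrZ normfV normr_id mulVf.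
rewrite T0 normr_le0 linearZ scaler_eq0 invr_eq0 (negbTE nx) /=.
by move/eqP.
Qed.

Lemma opnormZ (a : R) T : opnorm (a *: T) = `|a| * opnorm T.
Proof.
apply/eqP; rewrite eq_le opnormZ_le/=.
have [->|a0] := eqVneq a 0.
  rewrite normr0 mul0r; apply: le_trans (opnorm_bound (x := 0) _ _) => //.
  by rewrite normr0.
have an0 : 0 < `|a| by rewrite normr_gt0.
rewrite -ler_pdivlMl// -normfV (le_trans _ (opnormZ_le _ _))//.
by rewrite scalerA mulVf// scale1r.
Qed.

HB.instance Definition _ :=
  Lmodule_isNormed.Build R bdop ler_opnormD opnormZ opnorm0_eq0.

End BoundedOperators.

Notation "''L' ( E , F )" := (bdop E F) (at level 8, format "''L' ( E ,  F )").

Section LinearAlgebra.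
Context {R : realType} {E : normedModType R}.

Definition lin_span (S : set E) : set E :=
  [set y | exists n (e : 'I_n -> E) (c : 'I_n -> R),
     (forall i, S (e i)) /\ y = \sum_i c i *: e i].

Definition has_dim (S : set E) (n : nat) := exists e : 'I_n -> E,
  (forall c : 'I_n -> R, \sum_i c i *: e i = 0 -> forall i, c i = 0) /\
  S = lin_span (range e).

(* The classes of [e] form a basis of the quotient of [E] by [S]. *)
Definition has_codim (S : set E) (n : nat) := exists e : 'I_n -> E,
  (forall c : 'I_n -> R, S (\sum_i c i *: e i) -> forall i, c i = 0) /\
  (forall y, exists s (c : 'I_n -> R), S s /\ y = s + \sum_i c i *: e i).

End LinearAlgebra.

Definition fredholm_of_index (R : realType) (E F : normedModType R)
    (T : 'L(E, F)) (k : int) := exists n m : nat,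
  [/\ has_dim [set x | T x = 0] n, closed (range T), has_codim (range T) m
    & k = n%:Z - m%:Z].

Section WeakHessians.
Context {R : realType} (h : growth R).

(* [f] and [g] act in the same way on sequences lying in both domains. *)
Definition agree (a b c d : R) (f : Hsp h a -> Hsp h b) (g : Hsp h c -> Hsp h d) :=
  forall x y, seq_of x = seq_of y -> seq_of (f x) = seq_of (g y).

(* For a <= c, the intersection of L(H_a, H_b) and L(H_c, H_d) is the subspace
   [agree T.1 T.2] of this product, whose library norm is the maximum of the
   two operator norms. *)
Definition LL (a b c d : R) : normedModType R :=
  ('L(Hsp h a, Hsp h b) * 'L(Hsp h c, Hsp h d))%type.

Lemma LL_normE (a b c d : R) (T : LL a b c d) :
  `|T| = Num.max (opnorm T.1) (opnorm T.2).
Proof. by []. Qed.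

Definition weak_hessian : set (LL 1 0 2 1) :=
  [set A : LL 1 0 2 1 | [/\ agree A.1 A.2,
    fredholm_of_index A.1 0,
    forall x y : Hsp h 1, ip h 0 (A.1 x) y = ip h 0 x (A.1 y)
  & fredholm_of_index A.2 0]].

Definition eigenvector (A : LL 1 0 2 1) (l : R) (x : Hsp h 1) :=
  x != 0 /\ seq_of (A.1 x) = l *: seq_of x.

Definition eigenvalues (A : LL 1 0 2 1) : set R :=
  [set l | exists x, eigenvector A l x].

Definition floer : set (LL 1 0 2 1) :=
  [set A : LL 1 0 2 1 | [/\ weak_hessian A,
    infinite_set (eigenvalues A `&` [set l | 0 < l])
  & infinite_set (eigenvalues A `&` [set l | l < 0])]].

Definition floer_inv : set (LL 1 0 2 1) :=
  [set A : LL 1 0 2 1 | floer A /\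
    exists S : 'L(Hsp h 0, Hsp h 1), cancel A.1 S /\ cancel S A.1].

(* Closed span in H_0 of the eigenvectors with eigenvalue in [I]. *)
Definition spectral_space (I : set R) (A : LL 1 0 2 1) : set (Hsp h 0) :=
  closure (lin_span [set y : Hsp h 0 | exists l x,
    [/\ I l, eigenvector A l x & seq_of y = seq_of x]]).

Definition orth_proj (V : set (Hsp h 0)) (x : Hsp h 0) : Hsp h 0 :=
  xget 0 [set p : Hsp h 0 | V p /\
    forall v : Hsp h 0, V v -> ip h 0 (x - p) v = 0].

Definition spectral_proj (I : set R) (A : LL 1 0 2 1) : Hsp h 0 -> Hsp h 0 :=
  orth_proj (spectral_space I A).

Definition restricts_to (P : Hsp h 0 -> Hsp h 0) (Q : LL 2^-1 2^-1 (3 / 2) (3 / 2)) :=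
  agree P Q.1 /\ agree P Q.2.

(* The value is meaningful only when [spectral_proj I A] restricts to bounded
   operators on both spaces, which then determines it; otherwise it is 0. *)
Definition spectral_selector (I : set R) (A : LL 1 0 2 1) :
    LL 2^-1 2^-1 (3 / 2) (3 / 2) :=
  xget 0 [set Q : LL 2^-1 2^-1 (3 / 2) (3 / 2) | restricts_to (spectral_proj I A) Q].

Definition Pi_plus := spectral_selector [set l | 0 < l].
Definition Pi_minus := spectral_selector [set l | l < 0].

End WeakHessians.

Arguments weak_hessian {R} h.
Arguments floer {R} h.
Arguments floer_inv {R} h.
Arguments Pi_plus {R} h.
Arguments Pi_minus {R} h.

(* Main.v *)
(** Write [S = sign B = Pi_+ - Pi_-], so that [Pi_(+-) = (1 +- S) / 2], and let
    [e_B(x) = <|B|x, x>_0] with [|B| = S B].  By the Loewner-Heinz inequality [e_B]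
    is equivalent to the squared norm of [H_(1/2)], because [B : H_1 -> H_0] is an
    isomorphism.  For two invertible weak Hessians [A], [B], with [E = B - A], the
    difference [D = sign B - sign A] solves the Lyapunov equation
    [|B| D + D |A| = E - (sign B) E (sign A)], whose right-hand side is of size
    [|E|] from [H_1] to [H_0]; the operator arithmetic-geometric mean inequality
    turns this into [e_B(D x) <= C |E|^2 e_A(x)].  Hence [sign] is locally
    Lipschitz with values in [L(H_(1/2))].  On [H_(3/2)] one uses
    [sign B = B^-1 (sign B) B], where [B : H_(3/2) -> H_(1/2)] and its inverse are
    controlled by quadratic interpolation.  The Loewner-Heinz inequality, the
    interpolation and the arithmetic-geometric mean inequality are all instances
    of one comparison of quadratic forms, [form_comparison].  The neighborhood can
    be taken to be the whole of [floer_inv h]. *)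
Require Import Defs.
From HB Require Import structures.
From mathcomp Require Import all_boot all_order all_algebra.
From mathcomp Require Import all_classical all_reals all_analysis.
From mathcomp Require Import ring lra.
Set Implicit Arguments. Unset Strict Implicit. Unset Printing Implicit Defensive.
Import Order.TTheory GRing.Theory Num.Theory.
Import numFieldNormedType.Exports.
Local Open Scope classical_set_scope.
Local Open Scope ring_scope.

(** * Comparison of quadratic forms *)

Section QuadraticForms.
Context {R : realType}.

(** No square root or functional calculus of operators is used: [|B|] enters only as the sign times
    [B] and through its energy form. [form_comparison] replaces an extremal argument. Let s be the
    best constant in Q <= s r, with r(x) = g(P x, x). If a vector x with P x nonzero attained it, x
    would lie in the kernel of s r - Q, so Q(x, P x) = s g(P x, P x) and s <= c. Such a vector need
    not exist; Cauchy-Schwarz for s r - Q takes its place, at the price of P being bounded. Since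
    |A| and multiplication by h^(1/2) are unbounded, the comparison runs on finite combinations of
    eigenvectors or on truncated sequences. There the bound k of P depends on the combination, but
    the final constant c does not, so the conclusion passes to limits. The half-integer exponents
    have this origin: E loses a full degree, from H_1 to H_0, and the Lyapunov equation recovers it
    symmetrically, half on each side, which controls D on the middle space H_(1/2). All constants
    must be uniform near A. A bound for the inverse from H_1 to H_2 exists because the restriction
    to H_2 has index zero; its uniformity comes from absorbing a small perturbation. *)

Lemma discriminant_le0 (a b c : R) :
  (forall t, 0 <= a * t ^+ 2 + 2 * b * t + c) -> b ^+ 2 <= a * c.
Proof.
move=> H; have [a0|a0] := eqVneq a 0.
  have [->|b0] := eqVneq b 0; first by rewrite a0 mul0r expr0n.
  have := H (- (c + 1) / (2 * b)).
  suff -> : a * (- (c + 1) / (2 * b)) ^+ 2 + 2 * b * (- (c + 1) / (2 * b)) + c = -1.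
    by rewrite ler0N1.
  by rewrite a0; field.
have ap : 0 < a.
  rewrite lt_neqAle eq_sym a0 leNgt; apply/negP => an.
  (* For negative a, the identity |a| t = |a| + 2|b| + |c| together with t >= 1 lets a t^2 outweigh
     2 b t + c. *)
  pose t := (1 + (2 * `|b| + `|c|) / `|a|).
  have an0 : 0 < `|a| by rewrite normr_gt0.
  have t1 : 1 <= t by rewrite lerDl divr_ge0// addr_ge0// mulr_ge0.
  have e : `|a| * t = `|a| + 2 * `|b| + `|c|.
    by rewrite /t mulrDr mulr1 mulrC divfK ?gt_eqF// addrA.
  have := H t; apply/negP; rewrite -ltNge.
  have bt : b * t <= `|b| * t by rewrite ler_wpM2r ?ler_norm// (le_trans _ t1).
  have ct : c <= `|c| * t.
    by apply: le_trans (ler_norm c) _; rewrite ler_peMr.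
  have -> : a * t ^+ 2 = - (`|a| * t * t) by rewrite (ltr0_norm an); ring.
  rewrite e; nra.
have := H (- b / a).
have -> : a * (- b / a) ^+ 2 + 2 * b * (- b / a) + c = (a * c - b ^+ 2) / a by field.
by rewrite pmulr_lge0 ?invr_gt0// subr_ge0.
Qed.

Definition symbil (Z : lmodType R) (f : Z -> Z -> R) :=
  (forall x y, f x y = f y x) /\
  (forall a x y z, f (a *: x + y) z = a * f x z + f y z).

Lemma symbil_sqr (Z : lmodType R) (f : Z -> Z -> R) a x y : symbil f ->
  f (a *: x + y) (a *: x + y) = f x x * a ^+ 2 + 2 * f x y * a + f y y.
Proof.
move=> [fC fD]; rewrite fD (fC x) (fC y) !fD (fC y x); ring.
Qed.

Lemma symbil_CS (Z : lmodType R) (f : Z -> Z -> R) x y : symbil f ->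
  (forall z, 0 <= f z z) -> f x y ^+ 2 <= f x x * f y y.
Proof.
by move=> fb f0; apply: discriminant_le0 => t; rewrite -symbil_sqr.
Qed.

(* If [Q <= s r] with [s > c], Cauchy-Schwarz for the nonnegative form
   [s r - Q] at [z] and [P z] improves the constant [s]. *)
Lemma form_comparison (Z : lmodType R) (g Q : Z -> Z -> R) (P : Z -> Z)
    (k m c : R) :
  symbil g -> symbil Q -> (forall a x y, P (a *: x + y) = a *: P x + P y) ->
  (forall x y, g (P x) y = g x (P y)) ->
  (forall x, 0 <= g x x) -> (forall x, 0 <= g (P x) x) ->
  0 <= c -> 0 <= k -> 0 <= m ->
  (forall x, g (P x) (P x) <= k * g (P x) x) ->
  (forall x, g (P x) x <= m * g (P x) (P x)) ->
  (forall x, `|Q x x| <= m * g (P x) (P x)) ->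
  (forall x, Q x (P x) <= c * g (P x) (P x)) ->
  forall x, Q x x <= c * g (P x) x.
Proof.
move=> gb Qb Pl Ps g0 r0 c0 k0 m0 gk rm Qm QP.
(* The admissible constants from c upward; their infimum [s] is shown to be admissible, then not to
   exceed c. *)
pose D := [set s | c <= s /\ forall x, Q x x <= s * g (P x) x].
have cD s : D s -> c <= s by case.
have infD : has_inf D.
  split; last by exists c => s /cD.
  exists (c + m * k); split; first by rewrite lerDl mulr_ge0.
  move=> x; rewrite (le_trans (ler_norm _))// (le_trans (Qm x))//.
  rewrite mulrDl -mulrA (@le_trans _ _ (m * (k * g (P x) x)))//.
    by rewrite ler_wpM2l.
  by rewrite lerDr mulr_ge0.
pose s := inf D.
have cs : c <= s by apply: lb_le_inf; [exact: infD.1|exact: cD].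
have Qs x : Q x x <= s * g (P x) x.
  have [r1|r1] := ltP 0 (g (P x) x).
    rewrite -ler_pdivrMr//; apply: lb_le_inf; first exact: infD.1.
    by move=> t [_ tx]; rewrite ler_pdivrMr.
  have re : g (P x) x = 0 by apply/le_anti; rewrite r1 r0.
  rewrite (le_trans (ler_norm _))// (le_trans (Qm x))// re mulr0.
  by rewrite (le_trans (ler_wpM2l m0 (gk x)))// re !mulr0.
suff sc : s <= c by move=> x; rewrite (le_trans (Qs x))// ler_wpM2r.
rewrite leNgt; apply/negP => ltcs.
pose F x y := s * g (P x) y - Q x y.
have Fb : symbil F.
  split=> [x y|a x y z]; rewrite /F; first by rewrite Ps gb.1 Qb.1.
  by rewrite Pl gb.2 Qb.2; ring.
have F0 x : 0 <= F x x by rewrite subr_ge0.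
(* Cauchy-Schwarz for g gives r^2 <= g(P P x, P P x) g(P x, P x) <= k r g(P x, P x) with r = g(P P
   x, P x), and one factor r cancels. *)
have rP x : g (P (P x)) (P x) <= k * g (P x) (P x).
  have := symbil_CS (P (P x)) (P x) gb g0; set r := g (P (P x)) (P x).
  have := gk (P x); have := r0 (P x); have := g0 (P x); rewrite -/r.
  set G := g (P x) (P x); set G' := g (P (P x)) _ => G0 rr0 kr sr.
  have {}sr : r ^+ 2 <= k * r * G by apply: le_trans sr _; rewrite ler_wpM2r.
  have [re|rn] := eqVneq r 0; first by rewrite re mulr_ge0.
  have rp : 0 < r by rewrite lt_neqAle eq_sym rn.
  by rewrite -(ler_pM2l rp) -expr2 mulrCA mulrA.
have sp : 0 < s by apply: le_lt_trans ltcs.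
have [m1 [m1p FP]] : exists m1, 0 < m1 /\
    forall x, F (P x) (P x) <= m1 * g (P x) (P x).
  exists (s * k + m * k ^+ 2 + 1); split=> [|x].
    have : 0 <= s * k + m * k ^+ 2 by rewrite addr_ge0// mulr_ge0 ?exprn_ge0// ltW.
    by lra.
  have h1 : s * g (P (P x)) (P x) <= s * (k * g (P x) (P x)).
    by rewrite ler_wpM2l// ltW.
  have h2 : - Q (P x) (P x) <= m * (k * (k * g (P x) (P x))).
    rewrite (le_trans (ler_norm _))// normrN (le_trans (Qm _))// ler_wpM2l//.
    by rewrite (le_trans (gk _))// ler_wpM2l.
  have := g0 (P x); rewrite /F; nra.
(* With G = g(P x, P x): (s - c)^2 G^2 <= F(x, P x)^2 <= F(x, x) m1 G, and g(P x, x) <= m G. Hence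
   F(x, x) >= th g(P x, x); writing m + 1 keeps the denominator positive. *)
pose th := (s - c) ^+ 2 / (m1 * (m + 1)).
have m11 : 0 < m + 1 by lra.
have thp : 0 < th by rewrite divr_gt0 ?exprn_gt0 ?subr_gt0 ?mulr_gt0.
have Fth x : th * g (P x) x <= F x x.
  set G := g (P x) (P x).
  have G0 : 0 <= G by exact: g0.
  have CS := symbil_CS x (P x) Fb F0.
  have lo : (s - c) * G <= F x (P x).
    by rewrite /F -/G mulrBl lerB.
  have up := FP x; rewrite -/G in up.
  have [Ge|Gn] := eqVneq G 0.
    have -> : g (P x) x = 0.
      by apply/le_anti; rewrite r0 andbT (le_trans (rm x))// -/G Ge mulr0.
    by rewrite mulr0.
  have Gp : 0 < G by rewrite lt_neqAle eq_sym Gn.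
  have h1 : ((s - c) * G) ^+ 2 <= F x x * (m1 * G).
    apply: le_trans (le_trans CS _); last by rewrite ler_wpM2l.
    by rewrite ler_sqr ?nnegrE ?(le_trans _ lo)// mulr_ge0// subr_ge0 ltW.
  have h2 : (s - c) ^+ 2 * G <= F x x * m1.
    by rewrite -(ler_pM2r Gp) -mulrA -expr2 -exprMn -mulrA.
  rewrite /th mulrAC ler_pdivrMr ?mulr_gt0//.
  have h3 : g (P x) x <= (m + 1) * G.
    by apply: le_trans (rm x) _; rewrite ler_wpM2r// lerDl.
  have h4 : (s - c) ^+ 2 * g (P x) x <= (s - c) ^+ 2 * ((m + 1) * G).
    by rewrite ler_wpM2l// sqr_ge0.
  apply: le_trans h4 _.
  have -> : (s - c) ^+ 2 * ((m + 1) * G) = (m + 1) * ((s - c) ^+ 2 * G) by ring.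
  have -> : F x x * (m1 * (m + 1)) = (m + 1) * (F x x * m1) by ring.
  by rewrite ler_wpM2l// ltW.
(* The maximum with c keeps the improved constant in [D]; both of its entries lie strictly below s,
   against the choice of s as infimum. *)
have Dth : D (Num.max c (s - th)).
  split; first by rewrite le_max lexx.
  move=> x; apply: (@le_trans _ _ ((s - th) * g (P x) x)).
    by rewrite mulrBl lerBrDr addrC -lerBrDr; exact: Fth.
  by rewrite ler_wpM2r// le_max lexx orbT.
have := ge_inf infD.2 Dth; rewrite -/s le_max; apply/negP.
by rewrite negb_or -!ltNge ltcs/= ltrBlDr ltrDl.
Qed.

End QuadraticForms.

(** * Weighted sequence spaces *)

Section WeightedSequences.
Context {R : realType} (h : growth R).
Implicit Types (x y z : nat -> R) (r s a b : R).

(** Partial sums make sense for every sequence, so estimates are proved on them and then passed to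
    [ip] by monotone convergence. *)
Definition psum s x y : nat -> R := series (fun n => h n `^ s * x n * y n).

Lemma weight_gt0 s n : 0 < h n `^ s.
Proof. by rewrite powR_gt0 ?growth_gt0. Qed.

Lemma weightD s r n : h n `^ (s + r) = h n `^ s * h n `^ r.
Proof. by rewrite powRD// (gt_eqF (growth_gt0 h n)) implybT. Qed.

Lemma psum_term_ge0 s x n : 0 <= h n `^ s * x n * x n.
Proof. by rewrite -mulrA mulr_ge0 ?powR_ge0// -expr2 sqr_ge0. Qed.

Lemma psum_nd s x : nondecreasing_seq (psum s x x).
Proof. by apply: nondecreasing_series => n _ _; exact: psum_term_ge0. Qed.

Lemma psum_ge0 s x n : 0 <= psum s x x n.
Proof. by apply: sumr_ge0 => i _; exact: psum_term_ge0. Qed.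

Lemma wsummable_psum s x : x \in wsummable h s <-> cvgn (psum s x x).
Proof.
rewrite wsummableP (_ : psum s x x = series (fun n => h n `^ s * x n ^+ 2))//.
by congr series; apply/funext => n; rewrite expr2 mulrA.
Qed.

Lemma psum_le_ip s x n : x \in wsummable h s -> psum s x x n <= ip h s x x.
Proof.
by move=> /wsummable_psum cx; apply: nondecreasing_cvgn_le => //; exact: psum_nd.
Qed.

Lemma wsummable_le s x M : (forall n, psum s x x n <= M) ->
  x \in wsummable h s /\ ip h s x x <= M.
Proof.
move=> xM; have cx : cvgn (psum s x x).
  apply: nondecreasing_is_cvgn; first exact: psum_nd.
  by exists M => _ [n _ <-].
split; first exact/wsummable_psum.
by apply: limr_le => //; exact: nearW.
Qed.

Lemma ip_sqr_ge0 s x : x \in wsummable h s -> 0 <= ip h s x x.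
Proof. by move=> xs; exact: le_trans (psum_ge0 s x 0) (psum_le_ip 0 xs). Qed.

Lemma ipC s x y : ip h s x y = ip h s y x.
Proof. by congr (limn (series _)); apply/funext => n; rewrite mulrAC. Qed.

Lemma wsummable_tail s r x N M : s <= r ->
  (forall n, (n < N)%N -> x n = 0) -> (forall n, psum r x x n <= M) ->
  forall n, psum s x x n <= h N `^ (s - r) * M.
Proof.
move=> sr x0 xM n; apply: le_trans (ler_wpM2l (powR_ge0 _ _) (xM n)).
rewrite /psum /series /= mulr_sumr; apply: ler_sum => i _.
have [/x0 ->|Ni] := ltnP i N; first by rewrite !mulr0.
have -> : h i `^ s = h i `^ (s - r) * h i `^ r by rewrite -weightD subrK.
rewrite -!mulrA ler_wpM2r//.
  by rewrite mulr_ge0 ?powR_ge0// -expr2 sqr_ge0.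
rewrite -opprB !powRN lef_pV2 ?posrE ?weight_gt0//.
apply: ge0_ler_powR; rewrite ?nnegrE ?subr_ge0 ?(ltW (growth_gt0 _ _))//.
exact: growth_mono.
Qed.

Lemma wsummableW s r x : s <= r -> x \in wsummable h r ->
  x \in wsummable h s /\ ip h s x x <= h 0 `^ (s - r) * ip h r x x.
Proof.
move=> sr xr; apply: wsummable_le; apply: (wsummable_tail sr) => //.
by move=> n; exact: psum_le_ip.
Qed.

(** Splitting h^s = h^(a/2) h^(b/2) bounds each term by the sum of the corresponding terms of the
    two squared norms, so the series converges absolutely. *)
Lemma psum_mixed_cvg s a b x y : a + b = 2 * s ->
  x \in wsummable h a -> y \in wsummable h b -> cvgn (psum s x y).
Proof.
move=> abs xa yb; apply: normed_cvg.
apply: nondecreasing_is_cvgn; first by apply: nondecreasing_series => n _ _; exact: normr_ge0.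
exists (ip h a x x + ip h b y y) => _ [n _ <-].
apply: le_trans (lerD (psum_le_ip n xa) (psum_le_ip n yb)).
rewrite /psum /series /= -big_split/=; apply: ler_sum => i _.
have ea t : h i `^ t = (h i `^ (t / 2)) ^+ 2.
  by rewrite expr2 -weightD; congr (_ `^ _); field.
have -> : h i `^ s = h i `^ (a / 2) * h i `^ (b / 2).
  by rewrite -weightD; congr (_ `^ _); lra.
rewrite (ea a) (ea b); set u := h i `^ _; set v := h i `^ (b / 2).
rewrite ler_norml; apply/andP; split.
  have := sqr_ge0 (u * x i + v * y i); have := sqr_ge0 (u * x i - v * y i).
  nra.
have := sqr_ge0 (u * x i + v * y i); have := sqr_ge0 (u * x i - v * y i).
nra.
Qed.

Lemma ip_lin r a x x' y : x \in wsummable h r -> x' \in wsummable h r ->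
  y \in wsummable h r ->
  ip h r (a *: x + x') y = a * ip h r x y + ip h r x' y.
Proof.
move=> xr x'r yr; have rr : r + r = 2 * r by ring.
have c1 := psum_mixed_cvg rr xr yr; have c2 := psum_mixed_cvg rr x'r yr.
have F : (fun n => a * psum r x y n + psum r x' y n) @ \oo -->
    a * ip h r x y + ip h r x' y.
  by apply: cvgD; [apply: cvgMl_tmp; exact: c1|exact: c2].
rewrite -(cvg_lim _ F)//; congr (limn _); apply/funext => n.
rewrite /psum /series /= mulr_sumr -big_split; apply: eq_bigr => i _ /=.
have -> : (a *: x + x') i = a * x i + x' i by [].
ring.
Qed.

(** The pairing of H_a with H_b around their midpoint s. Termwise, the quadratic polynomial in t is
    the square of t h^(a/2) x + h^(b/2) y; its discriminant gives the inequality. *)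
Lemma ip_mixed_CS s a b x y : a + b = 2 * s ->
  x \in wsummable h a -> y \in wsummable h b ->
  ip h s x y ^+ 2 <= ip h a x x * ip h b y y.
Proof.
move=> abs xa yb; apply: discriminant_le0 => t.
have c1 := psum_mixed_cvg abs xa yb.
have /wsummable_psum c2 := xa; have /wsummable_psum c3 := yb.
have F : (fun n => psum a x x n * t ^+ 2 + 2 * psum s x y n * t + psum b y y n)
   @ \oo --> ip h a x x * t ^+ 2 + 2 * ip h s x y * t + ip h b y y.
  apply: cvgD; last exact: c3.
  apply: cvgD; first by apply: cvgMr_tmp; exact: c2.
  by apply: cvgMr_tmp; apply: cvgMl_tmp; exact: c1.
rewrite -(cvg_lim _ F)//; apply: limr_ge; first by apply/cvg_ex; eexists; exact: F.
near=> n; rewrite /psum /series /= mulr_suml mulr_sumr mulr_suml -!big_split/=.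
apply: sumr_ge0 => i _.
have ea p : h i `^ p = (h i `^ (p / 2)) ^+ 2.
  by rewrite expr2 -weightD; congr (_ `^ _); field.
have -> : h i `^ s = h i `^ (a / 2) * h i `^ (b / 2).
  by rewrite -weightD; congr (_ `^ _); lra.
rewrite (ea a) (ea b); set u := h i `^ _; set v := h i `^ (b / 2).
have -> : u ^+ 2 * x i * x i * t ^+ 2 + 2 * (u * v * x i * y i) * t
  + v ^+ 2 * y i * y i = (t * (u * x i) + v * y i) ^+ 2 by ring.
exact: sqr_ge0.
Unshelve. all: by end_near. Qed.

Lemma symbil_ip r : symbil (fun x y : Hsp h r => ip h r x y).
Proof.
split=> [x y|a x y z]; first exact: ipC.
by apply: ip_lin; exact: valP.
Qed.

Lemma HnormE r (x : Hsp h r) : `|x| ^+ 2 = ip h r x x.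
Proof. by rewrite [`|x|]/(Hnorm x) sqr_sqrtr// ip_ge0. Qed.

End WeightedSequences.

(** * Completeness of the weighted spaces and compactness of the inclusion of H_1 in H_0 *)

Section Embeddings.
Context {R : realType} (h : growth R).
Implicit Types (x y z : nat -> R) (r s a b : R).

(** A total coercion of raw sequences, with the default 0 outside the space; it moves one sequence
    between the spaces of the scale. *)
Definition emb s x : Hsp h s := insubd 0 x.

Lemma embK s x : x \in wsummable h s -> seq_of (emb s x) = x.
Proof. exact: insubdK. Qed.

Lemma seq_inj s (x y : Hsp h s) : seq_of x = seq_of y -> x = y.
Proof. exact: val_inj. Qed.

Lemma emb_seq s (x : Hsp h s) : emb s x = x.
Proof. by apply: seq_inj; rewrite embK//; exact: valP. Qed.

Lemma seq_lin s c (x y : Hsp h s) : seq_of (c *: x + y) = c *: seq_of x + seq_of y.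
Proof. by []. Qed.

Lemma seqB s (x y : Hsp h s) : seq_of (x - y) = seq_of x - seq_of y.
Proof. by []. Qed.

Lemma seqW s r (x : Hsp h r) : s <= r -> seq_of x \in wsummable h s.
Proof. by move=> sr; have [] := wsummableW sr (valP x). Qed.

Lemma emb_lin s c x y : x \in wsummable h s -> y \in wsummable h s ->
  emb s (c *: x + y) = c *: emb s x + emb s y.
Proof.
by move=> xs ys; apply: seq_inj; rewrite seq_lin !embK// rpredD// rpredZ.
Qed.

Lemma embB s x y : x \in wsummable h s -> y \in wsummable h s ->
  emb s (x - y) = emb s x - emb s y.
Proof.
by move=> xs ys; apply: seq_inj; rewrite seqB !embK// rpredB.
Qed.

Lemma norm_emb s x : x \in wsummable h s -> `|emb s x| ^+ 2 = ip h s x x.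
Proof. by move=> xs; rewrite HnormE embK. Qed.

Lemma coord_le s (x : Hsp h s) n : h n `^ s * x n ^+ 2 <= `|x| ^+ 2.
Proof.
rewrite HnormE; apply: le_trans (psum_le_ip n.+1 (valP x)).
by rewrite /psum /series /= big_nat_recr//= expr2 mulrA lerDr; exact: psum_ge0.
Qed.

Lemma cvg_coord (I : Type) (F : set_system I) {FF : Filter F} s
  (f : I -> Hsp h s) (z : Hsp h s) n :
  f @ F --> z -> f t n @[t --> F] --> z n.
Proof.
move=> fz; apply/cvgrPdist_le => e e0.
have wp : 0 < Num.sqrt (h n `^ s) by rewrite sqrtr_gt0 weight_gt0.
move/cvgrPdist_le: fz => /(_ (e * Num.sqrt (h n `^ s))) H.
near=> t; have H1 : `|z - f t| <= e * Num.sqrt (h n `^ s).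
  by near: t; apply: H; rewrite mulr_gt0.
rewrite -(ler_pM2r wp); apply: le_trans H1.
rewrite -ler_sqr ?nnegrE ?mulr_ge0 ?sqrtr_ge0// exprMn sqr_sqrtr ?powR_ge0//.
by rewrite real_normK ?num_real// mulrC; exact: (coord_le (z - f t) n).
Unshelve. all: by end_near. Qed.

Lemma cvg_psum (I : Type) (F : set_system I) {FF : Filter F} s
  (f : I -> nat -> R) (z : nat -> R) n : (forall k, f t k @[t --> F] --> z k) ->
  psum h s (f t) (f t) n @[t --> F] --> psum h s z z n.
Proof.
move=> fz; elim: n => [|n IH].
  rewrite /psum /series /= [X in _ --> X]big_geq//.
  rewrite (_ : (fun t => _) = fun=> 0); first exact: cvg_cst.
  by apply/funext => t; rewrite big_geq.
rewrite /psum /series /= [X in _ --> X]big_nat_recr//=.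
rewrite (_ : (fun t => _) =
  (fun t => psum h s (f t) (f t) n + h n `^ s * f t n * f t n)); last first.
  by apply/funext => t; rewrite big_nat_recr.
apply: cvgD => //; apply: cvgM => //.
by apply: cvgMl_tmp.
Qed.

(** Each partial sum involves finitely many coordinates, so its bound survives coordinatewise
    limits. Completeness, compactness and the passage from truncations to all sequences rest on
    this. *)
Lemma wsummable_fatou (I : Type) (F : set_system I) {FF : ProperFilter F} s M
  (f : I -> nat -> R) (z : nat -> R) : (forall k, f t k @[t --> F] --> z k) ->
  (\forall t \near F, f t \in wsummable h s /\ ip h s (f t) (f t) <= M) ->
  z \in wsummable h s /\ ip h s z z <= M.
Proof.
move=> fz fM; apply: wsummable_le => n.
apply: (cvgr_to_le (cvg_psum (s := s) (n := n) fz)); apply: filterS fM => t [ft].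
exact/le_trans/psum_le_ip.
Qed.

(** The coordinates have limits because they are controlled by the norm. Applying [wsummable_fatou]
    to x - y, with y running along the filter, shows both that the limit lies in the space and that
    it is close to x. *)
Lemma Hsp_complete s (F : set_system (Hsp h s)) :
  ProperFilter F -> cauchy F -> cvg F.
Proof.
move=> FF /cauchy_ballP Fc.
have [z zP] : exists z, forall n, (x : Hsp h s) n @[x --> F] --> z n.
  suff H n : exists l : R, (x : Hsp h s) n @[x --> F] --> l.
    by exists (fun n => projT1 (cid (H n))) => n; case: cid.
  apply/cvg_ex; apply: cauchy_cvg; apply/cauchy_ballP => e e0.
  have wp : 0 < Num.sqrt (h n `^ s) by rewrite sqrtr_gt0 weight_gt0.
  have [[A B]/= [FA FB] AB] := Fc _ (mulr_gt0 e0 wp).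
  exists ([set x n | x in A], [set x n | x in B]).
    by split; [apply: filterS FA|apply: filterS FB] => x ?; exists x.
  move=> [_ _] /= [[x Ax <-] [y By <-]]; have := AB (x, y) (conj Ax By).
  rewrite -!ball_normE/= => xy; rewrite -(ltr_pM2r wp); apply: le_lt_trans xy.
  rewrite -ler_sqr ?nnegrE ?mulr_ge0 ?sqrtr_ge0// exprMn sqr_sqrtr ?powR_ge0//.
  by rewrite real_normK ?num_real// mulrC; exact: (coord_le (x - y) n).
have close (e : R) : 0 < e -> exists A, F A /\
    forall x : Hsp h s, A x -> z \in wsummable h s /\ `|emb s z - x| <= e.
  move=> e0; have [[A B]/= [FA FB] AB] := Fc _ e0.
  exists A; split=> // x Ax.
  have [] := @wsummable_fatou _ F _ s (e ^+ 2) (fun y : Hsp h s => seq_of (x - y))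
     (seq_of x - z).
  - move=> k; rewrite (_ : (fun y : Hsp h s => _) = (fun y : Hsp h s => x k - y k))//.
    by apply: cvgB; [exact: cvg_cst|exact: zP].
  - apply: filterS FB => y By; split; first exact: valP.
    have := AB (x, y) (conj Ax By); rewrite -ball_normE /= => /ltW xy.
    rewrite -[leLHS]/(ip h s (seq_of (x - y)) (seq_of (x - y))) -HnormE.
    by rewrite ler_sqr ?nnegrE// ltW.
  move=> xz xze; have zs : z \in wsummable h s.
    by rewrite -[z](subKr (seq_of x)) rpredB//; exact: valP.
  split=> //; rewrite distrC -ler_sqr ?nnegrE ?(ltW e0)// HnormE.
  by rewrite seqB embK.
apply/cvg_ex; exists (emb s z); apply/cvgrPdist_le => e e0.
by have [A [FA AP]] := close _ e0; apply: filterS FA => x /AP[].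
Qed.

Lemma weight0 n : h n `^ 0 = 1. Proof. by rewrite powRr0. Qed.

(** Beyond N the growth function is at least h(N), so the H_1 norm controls the tail with the small
    factor h(N)^-1. *)
Lemma psum_split (x : nat -> R) N n :
  psum h 0 x x n <= psum h 0 x x N + (h N)^-1 * psum h 1 x x n.
Proof.
have hp k : 0 < h k := growth_gt0 h k.
elim: n => [|n IH].
  rewrite [X in X <= _]/psum /series /= big_geq// addr_ge0 ?psum_ge0//.
  by rewrite mulr_ge0 ?psum_ge0// invr_ge0 ltW.
have [nN|Nn] := ltnP n N.
  rewrite (le_trans (psum_nd h 0 x nN))// lerDl.
  by rewrite mulr_ge0 ?psum_ge0// invr_ge0 ltW.
rewrite {1}/psum /series /= big_nat_recr//= {2}/psum /series /= big_nat_recr//=.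
rewrite mulrDr addrA lerD// weight0 mul1r powRr1 ?(ltW (hp _))//.
rewrite ler_pdivlMl// -!mulrA ler_wpM2r//; last exact: growth_mono.
by rewrite -expr2 sqr_ge0.
Qed.

Lemma ultra_fmap (I J : Type) (f : I -> J) (G : set_system I) :
  UltraFilter G -> UltraFilter (f t @[t --> G]).
Proof.
move=> UG; split; first exact: fmap_proper_filter.
move=> H PH fH; rewrite predeqE => A; split; last exact: fH.
move=> HA; have [//|GA] := in_ultra_setVsetC (f @^-1` A) UG.
have HC : H (~` A) by exact: fH.
by have /filter_ex [? []] : H (A `&` (~` A)) by exact: filterI.
Qed.

(** An ultrafilter replaces the diagonal subsequence: all bounded coordinates converge along it at
    once, and [psum_split] makes the tails uniformly small in H_0. *)
Lemma compact_inclusion (f : nat -> Hsp h 1) (M : R) : (forall n, `|f n| <= M) ->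
  exists (G : set_system nat) (z : Hsp h 0),
    [/\ ProperFilter G, \oo `<=` G & emb 0 (f n) @[n --> G] --> z].
Proof.
move=> fM.
have [G [UG sG]] := ultraFilterLemma (eventually_filter : ProperFilter \oo).
have PG : ProperFilter G by exact: ultra_proper.
have M0 : 0 <= M by apply: le_trans (normr_ge0 _) (fM 0).
have hp k : 0 < h k := growth_gt0 h k.
have [z zP] : exists z : nat -> R, forall n, f t n @[t --> G] --> z n.
  suff H n : exists l : R, f t n @[t --> G] --> l.
    by exists (fun n => projT1 (cid (H n))) => n; case: cid.
  pose c := M / Num.sqrt (h n).
  have cpt := @segment_compact R (- c) c; rewrite compact_ultra in cpt.
  have [||l [_ fl]] := cpt (f t n @[t --> G]).
  - exact: ultra_fmap.
  - suff : \forall t \near G, `[- c, c]%classic (f t n) by [].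
    apply: filterE => t; rewrite /= in_itv/= -ler_norml /c ler_pdivlMr ?sqrtr_gt0 ?hp//.
    apply: le_trans (fM t).
    rewrite -ler_sqr ?nnegrE ?mulr_ge0 ?sqrtr_ge0// exprMn sqr_sqrtr ?(ltW (hp _))//.
    rewrite real_normK ?num_real// mulrC.
    by have := coord_le (f t) n; rewrite powRr1 ?(ltW (hp _)).
  by exists l.
have [z1 zM] : z \in wsummable h 1 /\ ip h 1 z z <= M ^+ 2.
  apply: (wsummable_fatou zP); apply: filterE => t; split; first exact: valP.
  by rewrite -HnormE ler_sqr ?nnegrE.
have z0 : z \in wsummable h 0 by have [] := wsummableW ler01 z1.
exists G, (emb 0 z); split=> //; apply/cvgrPdist_le => e e0.
(* The difference has H_1 norm at most 2 M, so its tail contributes at most 4 M^2 / h(N) <= e^2 / 2;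
   the first N coordinates contribute the other half. *)
have [N hN] := growth_unbounded h (8 * M ^+ 2 / e ^+ 2).
have dz k : seq_of (emb 1 z - f t) k @[t --> G] --> (0 : R).
  rewrite (_ : (fun t => _) = (fun t => z k - f t k)); last first.
    by apply/funext => t; rewrite seqB embK.
  rewrite -[X in _ --> X](subrr (z k)).
  by apply: cvgB; [exact: cvg_cst|exact: zP].
have psum0 : psum h 0 (seq_of (emb 1 z - f t)) (seq_of (emb 1 z - f t)) N
    @[t --> G] --> psum h 0 (fun=> 0) (fun=> 0) N by exact: cvg_psum.
move: psum0; rewrite [X in _ --> X](_ : _ = 0); last first.
  by rewrite /psum /series /= big1// => i _; rewrite mulr0.
move=> /cvgrPdist_le/(_ (e ^+ 2 / 2)) H.
have e2 : 0 < e ^+ 2 by rewrite exprn_gt0.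
near=> t.
have tN : psum h 0 (seq_of (emb 1 z - f t)) (seq_of (emb 1 z - f t)) N <= e ^+ 2 / 2.
  rewrite -[leLHS]ger0_norm ?psum_ge0// -normrN -sub0r.
  by near: t; apply: H; rewrite divr_gt0.
have d1 : `|emb 1 z - f t| <= 2 * M.
  rewrite (le_trans (ler_normB _ _))// mulr_natl mulr2n lerD//.
  by rewrite -ler_sqr ?nnegrE// norm_emb.
have f0 : seq_of (f t) \in wsummable h 0 by exact: seqW.
rewrite -embB//.
have dE : z - seq_of (f t) = seq_of (emb 1 z - f t) by rewrite seqB embK.
have d0 : z - seq_of (f t) \in wsummable h 0 by rewrite dE; exact: seqW.
rewrite -ler_sqr ?nnegrE ?(ltW e0)// norm_emb// dE.
suff bnd n : psum h 0 (seq_of (emb 1 z - f t)) (seq_of (emb 1 z - f t)) n <= e ^+ 2.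
  by have [] := wsummable_le bnd.
apply: le_trans (psum_split _ N n) _.
rewrite [leRHS]splitr lerD// ler_pdivrMl//.
apply: (le_trans (psum_le_ip n (valP (emb 1 z - f t)))); rewrite -HnormE.
apply: (@le_trans _ _ ((2 * M) ^+ 2)); first by rewrite ler_sqr ?nnegrE ?mulr_ge0.
move: hN; rewrite ltr_pdivrMr// => hN; nra.
Unshelve. all: by end_near. Qed.

End Embeddings.

HB.instance Definition _ (R : realType) (h : growth R) (s : R) :=
  Uniform_isComplete.Build (Hsp h s) (@Hsp_complete R h s).

(** * Orthogonal projections *)

Section BoundedOperators.
Context {R : realType} (E F : normedModType R).

Lemma opnorm_ge0 (T : 'L(E, F)) : 0 <= opnorm T.
Proof. exact: (normr_ge0 T). Qed.

Lemma opnorm_le (T : 'L(E, F)) x : `|T x| <= opnorm T * `|x|.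
Proof.
have [->|x0] := eqVneq x 0; first by rewrite linear0 !normr0 mulr0.
have xp : 0 < `|x| by rewrite normr_gt0.
have /bounded_linearP[_ [M TM]] := valP T.
rewrite -ler_pdivrMr// mulrC -[_^-1]ger0_norm ?invr_ge0// -normrZ -linearZ.
apply: ub_le_sup.
  exists `|M| => _ [y /= y1 <-]; rewrite (le_trans (TM y))//.
  by rewrite (le_trans (ler_norm _))// normrM normr_id ler_piMr.
exists (`|x|^-1 *: x) => //=.
by rewrite normrZ normfV normr_id mulVf// gt_eqF.
Qed.

Lemma le_opnorm (T : 'L(E, F)) M : 0 <= M ->
  (forall x, `|T x| <= M * `|x|) -> opnorm T <= M.
Proof.
move=> M0 TM; apply: ge_sup; first by exists `|T 0|, 0 => //=; rewrite normr0.
by move=> _ [x /= x1 <-]; rewrite (le_trans (TM x))// ler_piMr.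
Qed.

Lemma bdop_cvg (I : Type) (G : set_system I) {FG : Filter G} (T : 'L(E, F))
  (f : I -> E) x : f @ G --> x -> T (f t) @[t --> G] --> T x.
Proof.
move=> /cvgrPdist_le fx; apply/cvgrPdist_le => e e0.
have n0 := opnorm_ge0 T; have n1 : 0 < opnorm T + 1 by rewrite ltr_wpDl.
have := fx (e / (opnorm T + 1)) (divr_gt0 e0 n1); apply: filterS => t.
rewrite ler_pdivlMr// => xt; rewrite -linearB (le_trans (opnorm_le _ _))//.
by apply: le_trans xt; rewrite mulrC ler_wpM2l// lerDl.
Qed.

Lemma closureP (A : set E) x :
  closure A x <-> forall e, 0 < e -> exists2 a, A a & `|x - a| < e.
Proof.
split=> [Ax e e0|H B].
  have [a [Aa]] := Ax _ (nbhsx_ballx x e e0).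
  by rewrite -ball_normE /= => xa; exists a.
move=> /nbhs_ballP[e /= e0 xB]; have [a Aa xa] := H e e0.
by exists a; split=> //; apply: xB; rewrite -ball_normE.
Qed.

End BoundedOperators.

Definition subspace (R : realType) (E : normedModType R) (V : set E) :=
  V 0 /\ forall c x y, V x -> V y -> V (c *: x + y).

Section Subspaces.
Context {R : realType} {E : normedModType R}.

Lemma subspace_lin_span (S : set E) : subspace (lin_span S).
Proof.
split.
  exists 0%N, (fun=> 0), (fun=> 0); split=> [[]//|]; by rewrite big_ord0.
move=> c _ _ [n [e [a [Se ->]]]] [m [f [b [Sf ->]]]].
exists (n + m)%N, (fun i : 'I_(n + m) =>
  match fintype.split i with inl j => e j | inr j => f j end).
exists (fun i : 'I_(n + m) => match fintype.split i with inl j => c * a j | inr j => b j end).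
split=> [i|]; first by case: fintype.split.
rewrite big_split_ord/= scaler_sumr; congr (_ + _); apply: eq_bigr => i _.
  by rewrite (unsplitK (inl i)) scalerA.
by rewrite (unsplitK (inr i)).
Qed.

Lemma subspace_closure (V : set E) : subspace V -> subspace (closure V).
Proof.
move=> [V0 VD]; split; first exact: subset_closure.
move=> c x y /closureP Vx /closureP Vy; apply/closureP => e e0.
have c1 : 0 < `|c| + 1 by rewrite ltr_wpDl.
have e2 : 0 < e / 2 by rewrite divr_gt0.
have [a Va xa] := Vx _ (divr_gt0 e2 c1); have [b Vb yb] := Vy _ e2.
exists (c *: a + b); first exact: VD.
have -> : c *: x + y - (c *: a + b) = c *: (x - a) + (y - b).
  by rewrite scalerBr opprD addrACA.
rewrite (le_lt_trans (ler_normD _ _))// [e]splitr ler_ltD// normrZ.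
apply: (@le_trans _ _ ((`|c| + 1) * `|x - a|)); first by rewrite ler_wpM2r// lerDl.
by rewrite mulrC -ler_pdivlMr// ltW.
Qed.

Lemma lin_span_in (S V : set E) : subspace V -> S `<=` V -> lin_span S `<=` V.
Proof.
move=> [V0 VD] SV _ [n [e [c [Se ->]]]].
elim/big_ind: _ => // [x y Vx Vy|i _]; first by rewrite -[x]scale1r; exact: VD.
by rewrite -[_ *: _]addr0; apply: VD => //; exact: SV.
Qed.

Lemma sub_lin_span (S : set E) : S `<=` lin_span S.
Proof.
move=> x Sx; exists 1%N, (fun=> x), (fun=> 1); split=> //.
by rewrite big_ord1 scale1r.
Qed.

End Subspaces.

Record inner (R : realType) (E : normedModType R) := Inner {
  dot :> E -> E -> R;
  dot_symbil : symbil dot;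
  dotE : forall x, dot x x = `|x| ^+ 2 }.

Section InnerProduct.
Context {R : realType} {E : normedModType R} (ip : inner E).
Implicit Types (x y p v : E).

Let ipb := dot_symbil ip.
Let ipN := dotE ip.

Lemma dotC x y : ip x y = ip y x. Proof. exact: ipb.1. Qed.

Lemma dot_ge0 x : 0 <= ip x x. Proof. by rewrite ipN sqr_ge0. Qed.

Lemma dot_CS x y : `|ip x y| <= `|x| * `|y|.
Proof.
rewrite -ler_sqr ?nnegrE ?mulr_ge0// real_normK ?num_real// exprMn -!ipN.
by apply: symbil_CS => // z; exact: dot_ge0.
Qed.

Lemma dotDl c x y v : ip (c *: x + y) v = c * ip x v + ip y v.
Proof. exact: ipb.2. Qed.

Lemma dotDr c x y v : ip v (c *: x + y) = c * ip v x + ip v y.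
Proof. by rewrite dotC dotDl !(dotC v). Qed.

Lemma dotBl x y v : ip (x - y) v = ip x v - ip y v.
Proof. by rewrite -[- y]scaleN1r addrC dotDl mulN1r addrC. Qed.

Lemma dotBr x y v : ip v (x - y) = ip v x - ip v y.
Proof. by rewrite dotC dotBl !(dotC v). Qed.

Lemma dot0 v : ip 0 v = 0.
Proof. by rewrite -[X in ip X _](subrr v) dotBl subrr. Qed.

Lemma dotNl x v : ip (- x) v = - ip x v.
Proof. by rewrite -[- x]sub0r dotBl dot0 sub0r. Qed.

Lemma dotZl c x v : ip (c *: x) v = c * ip x v.
Proof. by rewrite -[c *: x]addr0 dotDl dot0 addr0. Qed.

Lemma dotZr c x v : ip v (c *: x) = c * ip v x.
Proof. by rewrite dotC dotZl dotC. Qed.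

Lemma cvg_dot (I : Type) (G : set_system I) {FG : Filter G}
  (f g : I -> E) x y : f @ G --> x -> g @ G --> y ->
  ip (f t) (g t) @[t --> G] --> ip x y.
Proof.
move=> fx gy; apply/cvgrPdist_le => e e0.
have k0 : 0 < `|x| + `|y| + 1 by rewrite ltr_wpDl// addr_ge0.
pose d := Num.min 1 (e / (`|x| + `|y| + 1)).
have d0 : 0 < d by rewrite lt_min ltr01 divr_gt0.
move/cvgrPdist_le: fx => /(_ d d0) fx; move/cvgrPdist_le: gy => /(_ d d0) gy.
near=> t.
have xf : `|x - f t| <= d by near: t.
have yg : `|y - g t| <= d by near: t.
have d1 : d <= 1 by rewrite /d ge_min lexx.
have de : d * (`|x| + `|y| + 1) <= e.
  by rewrite -ler_pdivlMr// /d ge_min lexx orbT.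
have -> : ip x y - ip (f t) (g t)
    = ip x (y - g t) + ip (x - f t) y
      - ip (x - f t) (y - g t).
  by rewrite !dotBl !dotBr; ring.
rewrite (le_trans (ler_normB _ _))//.
rewrite (le_trans (lerD (ler_normD _ _) (lexx _)))//.
rewrite (le_trans (lerD (lerD (dot_CS _ _) (dot_CS _ _)) (dot_CS _ _)))//.
have := normr_ge0 x; have := normr_ge0 y.
have := normr_ge0 (x - f t); have := normr_ge0 (y - g t).
nra.
Unshelve. all: by end_near. Qed.

Lemma norm_sqrD x y : `|x + y| ^+ 2 = `|x| ^+ 2 + 2 * ip x y + `|y| ^+ 2.
Proof.
rewrite -!ipN -[x]scale1r (symbil_sqr _ _ _ ipb) scale1r; ring.
Qed.

Lemma norm_sqrB x y : `|x - y| ^+ 2 = `|x| ^+ 2 - 2 * ip x y + `|y| ^+ 2.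
Proof. by rewrite norm_sqrD normrN dotC dotNl dotC; ring. Qed.

Lemma norm_sqrZD t x y :
  `|t *: x + y| ^+ 2 = t ^+ 2 * `|x| ^+ 2 + 2 * (t * ip y x) + `|y| ^+ 2.
Proof.
by rewrite norm_sqrD normrZ exprMn real_normK ?num_real// dotZl dotC.
Qed.

End InnerProduct.

Section Projection.
Context {R : realType} {E : completeNormedModType R} (ip : inner E).
Implicit Types (x y p v : E) (V : set E).

(** The nearly minimizing points form a Cauchy filter base by the parallelogram law. Orthogonality
    is the first-order condition at the minimizer, read off a discriminant whose constant term is
    0. *)
Lemma projection_exists V x : subspace V -> closed V ->
  exists p, V p /\ forall v, V v -> ip (x - p) v = 0.
Proof.
move=> [V0 VD] Vc; pose D := [set `|x - v| ^+ 2 | v in V].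
have infD : has_inf D.
  split; first by exists (`|x - 0| ^+ 2), 0.
  by exists 0 => _ [v _ <-]; rewrite sqr_ge0.
pose d := inf D.
have dV v : V v -> d <= `|x - v| ^+ 2 by move=> Vv; apply: (ge_inf infD.2); exists v.
pose B e := [set v | V v /\ `|x - v| ^+ 2 < d + e].
have Bne e : 0 < e -> B e !=set0.
  by move=> e0; have [_ [v Vv <-] ve] := inf_adherent e0 infD; exists v.
pose F := filter_from [set e : R | 0 < e] B.
have FF : ProperFilter F.
  apply: filter_from_proper; last exact: Bne.
  apply: filter_from_filter; first by exists 1 => /=.
  move=> e1 e2 /= e10 e20; exists (Num.min e1 e2); first by rewrite /= lt_min e10.
  move=> v [Vv vd]; split; split=> //; apply: lt_le_trans vd _;
    by rewrite lerD2l ge_min lexx ?orbT.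
(* The midpoint of v and w lies in V, so its distance to x is bounded below by the infimum; the
   parallelogram law then bounds |v - w|. *)
have par v w e : B e v -> B e w -> `|v - w| ^+ 2 <= 4 * e.
  move=> [Vv ve] [Vw we].
  have Vm : V (2^-1 *: v + 2^-1 *: w).
    by apply: (VD) => //; rewrite -[_ *: w]addr0; exact: VD.
  have dm := dV _ Vm.
  have e1 : `|x - (2^-1 *: v + 2^-1 *: w)| ^+ 2 * 4 = `|(x - v) + (x - w)| ^+ 2.
    have -> : (x - v) + (x - w) = 2%:R *: (x - (2^-1 *: v + 2^-1 *: w)).
      rewrite scalerBr scalerDr !scalerA mulfV// !scale1r scaler_nat mulr2n.
      by rewrite opprD addrACA.
    by rewrite normrZ exprMn normr_nat -natrX mulrC.
  have e2 : `|v - w| ^+ 2 = `|(x - w) - (x - v)| ^+ 2.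
    by rewrite opprB [x - w + _]addrC addrA subrK.
  rewrite (norm_sqrD ip (x - v)) in e1; rewrite (norm_sqrB ip (x - w)) in e2.
  have i12 := dotC ip (x - v) (x - w).
  rewrite e2 -i12; move: ve we dm e1 {i12 e2}.
  set a := `|x - v| ^+ 2; set b := `|x - w| ^+ 2; set c := `|x - _| ^+ 2.
  by set i := ip _ _; move: a b c i => a b c i; lra.
have Fc : cauchy F.
  apply/cauchy_ballP => e e0; have e4 : 0 < e ^+ 2 / 8.
    by rewrite divr_gt0// exprn_gt0.
  exists (B (e ^+ 2 / 8), B (e ^+ 2 / 8)) => /=; first by split; exists (e ^+ 2 / 8).
  move=> [v w]/= [Bv Bw]; rewrite -ball_normE /=.
  rewrite -ltr_sqr ?nnegrE ?(ltW e0)//; apply: le_lt_trans (par _ _ _ Bv Bw) _.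
  by have : 0 < e ^+ 2 by [rewrite exprn_gt0]; lra.
have [p Fp] : exists p : E, F --> p by apply/cvg_ex; exact: cauchy_cvg.
have Vp : V p.
  by apply: (@closed_cvg _ _ F _ id V Vc) Fp; exists 1 => //= v [].
have pd : `|x - p| ^+ 2 <= d.
  apply/ler_addgt0Pr => e e0.
  have xF : `|x - v| ^+ 2 @[v --> F] --> `|x - p| ^+ 2.
    by apply: cvgM; apply: cvg_norm; apply: cvgB => //; exact: cvg_cst.
  by apply: (cvgr_to_le xF); exists e => //= v [_ /ltW].
exists p; split=> // v Vv; apply/eqP; rewrite -sqrf_eq0 eq_le sqr_ge0 andbT.
rewrite -[leRHS](mulr0 (`|v| ^+ 2)); apply: discriminant_le0 => t.
have Vpt : V (- t *: v + p) by exact: VD.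
have e : x - (- t *: v + p) = t *: v + (x - p).
  by rewrite opprD scaleNr opprK addrCA.
have := le_trans pd (dV _ Vpt); rewrite e.
have /eqP {e} := norm_sqrZD ip t v (x - p); move: (`|t *: v + _| ^+ 2) => q /eqP ->.
move: (`|v| ^+ 2) (`|x - p| ^+ 2) (ip _ _) => a b i; lra.
Qed.

(** The same choice expression as [orth_proj], so that the two coincide once the inner products are
    identified. *)
Definition proj (V : set E) x : E :=
  xget 0 [set p | V p /\ forall v, V v -> ip (x - p) v = 0].

Variable V : set E.
Hypotheses (Vs : subspace V) (Vc : closed V).

Lemma projP x : V (proj V x) /\
  forall v, V v -> ip (x - proj V x) v = 0.
Proof.
rewrite /proj; set S := (X in xget _ X); have := @xgetPex _ 0 S; apply.
exact: projection_exists.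
Qed.

Lemma proj_unique x p : V p ->
  (forall v, V v -> ip (x - p) v = 0) -> proj V x = p.
Proof.
move=> Vp xp; have [Vq xq] := projP x; set q := proj V x in Vq xq *.
have Vqp : V (q - p) by rewrite addrC -scaleN1r; exact: Vs.2.
apply/eqP; rewrite -subr_eq0 -normr_eq0 -sqrf_eq0 -(dotE ip).
have -> : ip (q - p) (q - p) =
  ip (x - p) (q - p) - ip (x - q) (q - p).
  by rewrite -dotBl; congr (dot _ _ _); rewrite opprB [RHS]addrC addrA subrK.
by rewrite xp// xq// subrr.
Qed.

Lemma proj_lin c x y :
  proj V (c *: x + y) = c *: proj V x + proj V y.
Proof.
have [Vx xV] := projP x; have [Vy yV] := projP y.
apply: proj_unique; first exact: Vs.2.
move: (proj V x) (proj V y) Vx Vy xV yV => p q Vp Vq xp yq v Vv.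
have -> : c *: x + y - (c *: p + q) = c *: (x - p) + (y - q).
  by rewrite scalerBr opprD addrACA.
by rewrite dotDl yq// addr0 xp// mulr0.
Qed.

Lemma proj_sym x y : ip (proj V x) y = ip x (proj V y).
Proof.
move: (projP x) (projP y).
move: (proj V x) (proj V y) => p q [Vp xp] [Vq yq].
have e1 : ip x q = ip p q.
  by apply/eqP; rewrite -subr_eq0 -dotBl; apply/eqP; exact: xp.
have e2 : ip y p = ip q p.
  by apply/eqP; rewrite -subr_eq0 -dotBl; apply/eqP; exact: yq.
by rewrite e1 [LHS]dotC [RHS]dotC.
Qed.

End Projection.

(** * Self-adjoint operators with compact inverse *)

Section BdopMorphism.
Context {R : realType} (E F : normedModType R) (T : 'L(E, F)).

Lemma bdop0 : T 0 = 0. Proof. exact: linear0. Qed.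
Lemma bdopZ a x : T (a *: x) = a *: T x. Proof. exact: linearZ. Qed.
Lemma bdopD x y : T (x + y) = T x + T y. Proof. exact: linearD. Qed.
Lemma bdopB x y : T (x - y) = T x - T y. Proof. exact: linearB. Qed.

Lemma preimage_bdop_closed (V : set F) :
  closed V -> closed [set x | V (T x)].
Proof.
by move=> Vc; apply: preimage_closed => // x _; apply: bdop_cvg; exact: cvg_id.
Qed.

Lemma preimage_bdop_subspace (V : set F) :
  subspace V -> subspace [set x | V (T x)].
Proof.
move=> [V0 VD]; split=> [|c x y Vx Vy] /=; first by rewrite bdop0.
by rewrite linearP; exact: VD.
Qed.

End BdopMorphism.

Lemma near_natSinv_le (R : realType) (e : R) : 0 < e ->
  \forall n \near \oo, n.+1%:R^-1 <= e.
Proof.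
move=> e0; have := near_infty_natSinv_lt (PosNum e0).
by apply: filterS => n /ltW.
Qed.

Section InnerSums.
Context {R : realType} {E : normedModType R} (ip : inner E).

Lemma dot_suml n (c : 'I_n -> R) (e : 'I_n -> E) v :
  ip (\sum_i c i *: e i) v = \sum_i c i * ip (e i) v.
Proof.
elim/big_ind2: _ => [|a x b y <- <-|i _]; first exact: dot0.
  by rewrite -[x]scale1r dotDl mul1r scale1r.
exact: dotZl.
Qed.

Lemma dot_sumr n (c : 'I_n -> R) (e : 'I_n -> E) v :
  ip v (\sum_i c i *: e i) = \sum_i c i * ip v (e i).
Proof. by rewrite dotC dot_suml; apply: eq_bigr => i _; rewrite dotC. Qed.

Lemma closed_orth (S : set E) :
  closed [set v : E | forall u, S u -> ip v u = 0].
Proof.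
move=> v Hv u Su; have /closureP cl := Hv.
apply/eqP; rewrite -normr_le0; apply/ler_addgt0Pr => e e0; rewrite add0r.
have u1 : 0 < `|u| + 1 by rewrite ltr_wpDl.
have [w wS vw] := cl _ (divr_gt0 e0 u1).
have -> : ip v u = ip (v - w) u by rewrite dotBl wS// subr0.
rewrite (le_trans (dot_CS _ _ _))//.
apply: (@le_trans _ _ (`|v - w| * (`|u| + 1))); first by rewrite ler_wpM2l// lerDl.
by rewrite -ler_pdivlMr// ltW.
Qed.

Lemma subspace_orth (S : set E) :
  subspace [set v : E | forall u, S u -> ip v u = 0].
Proof.
split=> [u _|c x y Sx Sy u Su]; first exact: dot0.
by rewrite dotDl Sx// Sy// mulr0 addr0.
Qed.

End InnerSums.

(* An unbounded operator [A] on [E0] with domain [inc E1] and bounded inverse. *)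
Record selfadjoint (R : realType) (E0 E1 : normedModType R) (ip : inner E0)
    (inc : 'L(E1, E0)) := SelfAdjoint {
  sa_op :> 'L(E1, E0);
  sa_inv : 'L(E0, E1);
  sa_opK : cancel sa_op sa_inv;
  sa_invK : cancel sa_inv sa_op;
  sa_sym : forall x y, ip (sa_op x) (inc y) = ip (inc x) (sa_op y) }.

Section SpectralTheorem.
Context {R : realType} {E0 : completeNormedModType R} {E1 : normedModType R}.
Context {ip : inner E0} {inc : 'L(E1, E0)}.
Hypotheses (inc_inj : injective inc)
  (inc_compact : forall (f : nat -> E1) M, (forall n, `|f n| <= M) ->
     exists (G : set_system nat) (z : E0),
       [/\ ProperFilter G, \oo `<=` G & inc (f n) @[n --> G] --> z]).
Variable A : selfadjoint ip inc.

Local Notation T := (sa_inv A).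
Let AK := sa_opK A.
Let TK := sa_invK A.
Let Asym := sa_sym A.

Definition eigen l x := x != 0 /\ A x = l *: inc x.

Lemma inverse_sym (u v : E0) : ip (inc (T u)) v = ip u (inc (T v)).
Proof. by rewrite -{1}[v]TK -Asym TK. Qed.

Lemma eigen_T l x : eigen l x -> x = l *: T (inc x).
Proof. by move=> [_ Ax]; rewrite -{1}[x]AK Ax bdopZ. Qed.

Lemma eigenvalue_neq0 l x : eigen l x -> l != 0.
Proof.
move=> Ax; have [x0 _] := Ax; apply: contra_neq x0 => l0.
by rewrite (eigen_T Ax) l0 scale0r.
Qed.

Lemma eigen_of_inverse l v : v != 0 -> l != 0 -> inc (T v) = l *: v ->
  eigen l^-1 (T v).
Proof.
move=> v0 l0 Tv; split.
  by apply: contra_neq v0 => Tv0; rewrite -[v]TK Tv0 bdop0.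
by rewrite TK Tv scalerA mulVf// scale1r.
Qed.

Lemma eigen_orth l m x y : eigen l x -> eigen m y ->
  l != m -> ip (inc x) (inc y) = 0.
Proof.
move=> [_ Ax] [_ Ay] lm.
have := Asym x y; rewrite Ax Ay dotZl dotZr => /eqP.
by rewrite -subr_eq0 -mulrBl mulf_eq0 subr_eq0 (negbTE lm) /= => /eqP.
Qed.

Lemma inc_neq0 x : x != 0 -> inc x != 0.
Proof. by apply: contra_neq => x0; apply: inc_inj; rewrite x0 bdop0. Qed.

Lemma incT_le (u : E0) : `|inc (T u)| <= (opnorm inc * opnorm T) * `|u|.
Proof.
rewrite (le_trans (opnorm_le _ _))// -mulrA ler_wpM2l ?opnorm_ge0//.
exact: opnorm_le.
Qed.

(* A maximizing sequence of [|T u|] on the unit ball of [N] converges along an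
   ultrafilter to an eigenvector [w] of [T^2]; then [T w + m w] or [w] is an
   eigenvector of [T]. *)
Lemma eigen_exists (N : set (E0)) u0 : subspace N -> closed N ->
  (forall u, N u -> N (inc (T u))) -> N u0 -> u0 != 0 ->
  exists l x, eigen l x /\ N (inc x).
Proof.
move=> [N0 ND] Nc NT Nu0 u00.
have T0 v : v != 0 -> inc (T v) != 0.
  move=> v0; apply: inc_neq0; apply: contra_neq v0 => Tv0.
  by rewrite -[v]TK Tv0 bdop0.
have NZ c x : N x -> N (c *: x) by move=> Nx; rewrite -[_ *: _]addr0; exact: ND.
pose D := [set `|inc (T u)| ^+ 2 | u in [set u | N u /\ `|u| <= 1]].
have supD : has_sup D.
  split; first by exists (`|inc (T 0)| ^+ 2), 0; rewrite //= normr0.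
  exists ((opnorm inc * opnorm T) ^+ 2) => _ [u [_ u1] <-].
  rewrite ler_sqr ?nnegrE ?mulr_ge0 ?opnorm_ge0//.
  by rewrite (le_trans (incT_le u))// ler_piMr ?mulr_ge0 ?opnorm_ge0.
pose m2 := sup D.
have Tm v : N v -> `|inc (T v)| ^+ 2 <= m2 * `|v| ^+ 2.
  move=> Nv; have [->|v0] := eqVneq v 0.
    by rewrite !bdop0 normr0 expr0n /= mulr0.
  have vp : 0 < `|v| by rewrite normr_gt0.
  rewrite -ler_pdivrMr ?exprn_gt0//; apply: (ub_le_sup supD.2).
  exists (`|v|^-1 *: v).
    by split; [exact: NZ|rewrite normrZ normfV normr_id mulVf// gt_eqF].
  by rewrite !bdopZ normrZ exprMn normfV normr_id exprVn mulrC.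
have m20 : 0 < m2.
  have := Tm _ Nu0; have : 0 < `|inc (T u0)| ^+ 2 by rewrite exprn_gt0// normr_gt0 T0.
  move=> /lt_le_trans/[apply]; rewrite pmulr_lgt0// exprn_gt0// normr_gt0//.
have [u uP] : exists u : nat -> E0, forall n, [/\ N (u n), `|u n| <= 1
    & m2 - n.+1%:R^-1 < `|inc (T (u n))| ^+ 2].
  suff H n : exists v : E0, [/\ N v, `|v| <= 1
      & m2 - n.+1%:R^-1 < `|inc (T v)| ^+ 2].
    by exists (fun n => projT1 (cid (H n))) => n; case: cid.
  have n0 : 0 < n.+1%:R^-1 :> R by rewrite invr_gt0.
  by have [_ [v [Nv v1] <-] vm] := sup_adherent n0 supD; exists v.
have [|G [z [PG oG Gz]]] := inc_compact (f := T \o u) (M := opnorm T).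
  move=> n; have [_ u1 _] := uP n.
  by rewrite (le_trans (opnorm_le _ _))// ler_piMr ?opnorm_ge0.
have Guz : inc (T (inc (T (u n)))) @[n --> G] --> inc (T z).
  by apply: bdop_cvg; exact: bdop_cvg.
have norm_z : m2 <= `|z| ^+ 2.
  apply/ler_addgt0Pr => e e0.
  have zG : `|inc (T (u n))| ^+ 2 @[n --> G] --> `|z| ^+ 2.
    by apply: cvgM; exact: cvg_norm.
  rewrite -lerBlDr; apply: (cvgr_to_ge zG); apply: oG; near=> n.
  have [_ _ /ltW] := uP n; apply: le_trans; rewrite lerD2l lerN2.
  by near: n; exact: near_natSinv_le.
pose w := m2^-1 *: inc (T z).
have m2n : m2 != 0 by rewrite gt_eqF.
(* With T standing for [inc \o T]: |T^2 u - m2 u|^2 = |T^2 u|^2 - 2 m2 |T u|^2 + m2^2 |u|^2 <= m2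
   (m2 - |T u|^2), which tends to 0 along the maximizing sequence. *)
have Guw : u n @[n --> G] --> w.
  suff : m2 *: u n @[n --> G] --> m2 *: w.
    move=> /(cvgZl_tmp (k := m2^-1)); rewrite scalerA mulVf// scale1r.
    by apply: cvg_trans; apply: near_eq_cvg; near=> n => /=; rewrite scalerA mulVf// scale1r.
  rewrite /w scalerA mulfV// scale1r.
  rewrite -[X in _ --> X]subr0.
  rewrite (_ : (fun n => _) = (fun n => inc (T (inc (T (u n)))) -
    (inc (T (inc (T (u n)))) - m2 *: u n))); last first.
    by apply/funext => n; rewrite subKr.
  apply: cvgB => //; apply/cvgrPdist_le => e e0; apply: oG.
  near=> n; rewrite sub0r normrN.
  have [Nu u1 /ltW um] := uP n.
  have um2 := Tm _ (NT _ Nu); set t := `|inc (T (u n))| ^+ 2 in um um2.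
  have nn : n.+1%:R^-1 <= e ^+ 2 / m2.
    by near: n; apply: near_natSinv_le; rewrite divr_gt0// exprn_gt0.
  rewrite -ler_sqr ?nnegrE ?(ltW e0)// (norm_sqrB ip).
  have -> : ip (inc (T (inc (T (u n))))) (m2 *: u n) = m2 * t.
    by rewrite dotZr inverse_sym dotE.
  rewrite normrZ exprMn (ger0_norm (ltW m20)).
  have u2 : `|u n| ^+ 2 <= 1 by rewrite expr_le1.
  have nm : n.+1%:R^-1 * m2 <= e ^+ 2 by rewrite -ler_pdivlMr.
  have : m2 ^+ 2 * `|u n| ^+ 2 <= m2 ^+ 2 by rewrite ler_piMr// sqr_ge0.
  have : m2 * (m2 - n.+1%:R^-1) <= m2 * t by rewrite ler_wpM2l// ltW.
  have arith (a b c q k d : R) : c * k <= d -> a <= k * q ->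
    k ^+ 2 * b <= k ^+ 2 -> k * (k - c) <= k * q -> a - 2 * (k * q) + k ^+ 2 * b <= d.
    by nra.
  by move=> h1 h2; exact: arith nm um2 h2 h1.
have Nw : N w.
  apply: (@closed_cvg _ _ G _ u N Nc _ _ Guw).
  by apply: filterE => n; have [] := uP n.
have Tw : inc (T w) = z.
  apply: cvg_unique Gz => //.
  by apply: bdop_cvg; exact: bdop_cvg.
have w0 : w != 0.
  apply/eqP => w0; move: norm_z; rewrite -Tw w0 !bdop0 normr0 expr0n /=.
  by rewrite leNgt m20.
have TTw : inc (T (inc (T w))) = m2 *: w.
  by rewrite Tw /w scalerA mulfV// scale1r.
pose m := Num.sqrt m2.
have mm : m * m = m2 by rewrite -expr2 sqr_sqrtr// ltW.
have m0 : m != 0 by rewrite gt_eqF// sqrtr_gt0.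
have [v0|v0] := eqVneq (inc (T w) + m *: w) 0.
  have Twm : inc (T w) = - m *: w by apply/eqP; rewrite scaleNr -addr_eq0 v0.
  exists (- m)^-1, (T w); split; last exact: NT.
  by apply: eigen_of_inverse => //; rewrite oppr_eq0.
set v := _ + _ in v0.
have Nv : N v by rewrite /v addrC; apply: ND => //; exact: NT.
exists m^-1, (T v); split; last exact: NT.
apply: eigen_of_inverse => //.
by rewrite /v !bdopD TTw !bdopZ scalerDr [m *: (m *: _)]scalerA mm addrC.
Unshelve. all: by end_near. Qed.

Definition eset (I : set R) : set E0 :=
  [set y | exists l x, [/\ I l, eigen l x & y = inc x]].

Definition espace (I : set R) : set E0 := closure (lin_span (eset I)).

Lemma espace_subspace I : subspace (espace I).
Proof. exact/subspace_closure/subspace_lin_span. Qed.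

Lemma espace_closed I : closed (espace I).
Proof. exact: closed_closure. Qed.

(** Induction principle for spectral spaces: a closed linear condition has to be checked on
    eigenvectors only. *)
Lemma espace_min I W : subspace W -> closed W -> eset I `<=` W -> espace I `<=` W.
Proof.
move=> Ws Wc IW; rewrite /espace closureE => x; apply.
by split=> //; exact: lin_span_in.
Qed.

Lemma espace_eigen (I : set R) l x : I l -> eigen l x -> espace I (inc x).
Proof.
by move=> Il lx; apply: subset_closure; apply: sub_lin_span; exists l, x.
Qed.

Lemma incT_eigen l x : eigen l x -> inc (T (inc x)) = l^-1 *: inc x.
Proof.
move=> lx; have l0 := eigenvalue_neq0 lx.
by rewrite [in RHS](eigen_T lx) bdopZ scalerA mulVf// scale1r.
Qed.

Lemma espaceT I u : espace I u -> espace I (inc (T u)).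
Proof.
apply: (espace_min (W := [set u | espace I (inc (T u))])).
- apply: (@preimage_bdop_subspace _ _ _ T [set x | espace I (inc x)]).
  exact: (@preimage_bdop_subspace _ _ _ inc (espace I) (espace_subspace I)).
- apply: (@preimage_bdop_closed _ _ _ T [set x | espace I (inc x)]).
  exact: (@preimage_bdop_closed _ _ _ inc (espace I) (@espace_closed I)).
- move=> _ [l [x [Il lx ->]]] /=; rewrite (incT_eigen lx).
  rewrite -[_ *: _]addr0; have [S0 SD] := espace_subspace I; apply: SD => //.
  exact: espace_eigen lx.
Qed.

Lemma espace_orth (I J : set R) u v : (forall l, I l -> J l -> False) ->
  espace I u -> espace J v -> ip u v = 0.
Proof.
move=> IJ Iu Jv; have H w : eset J w -> ip u w = 0.
  move=> [m [y [Jm my ->]]].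
  apply: (@espace_min I [set u | forall w, [set inc y] w -> ip u w = 0]) Iu _ _ => //.
  - exact: subspace_orth.
  - exact: closed_orth.
  - move=> _ [l [x [Il lx ->]]] _ ->; apply: eigen_orth lx my _.
    by apply/eqP => lm; apply: (IJ l); rewrite // lm.
rewrite dotC; apply: (@espace_min J [set v | forall w, [set u] w -> ip v w = 0]) Jv _ _ => //.
- exact: subspace_orth.
- exact: closed_orth.
- by move=> w /H + _ ->; rewrite dotC.
Qed.

(** The orthogonal complement of all eigenvectors is closed and invariant under the inverse. If it
    were nonzero, [eigen_exists] would produce in it an eigenvector orthogonal to itself. *)
Lemma orth_eigen0 u : (forall l x, eigen l x -> ip u (inc x) = 0) -> u = 0.
Proof.
move=> ux; apply/eqP/negPn/negP => u0.
pose N := [set u | forall v, eset setT v -> ip u v = 0].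
have [||v Nv|v [l [x [_ lx ->]]]||l [x [lx Nx]]] := @eigen_exists N u.
- exact: subspace_orth.
- exact: closed_orth.
- move=> _ [l [x [_ lx ->]]].
  by rewrite inverse_sym (incT_eigen lx) dotZr Nv ?mulr0//; exists l, x.
- exact: ux lx.
- exact: u0.
have := Nx (inc x) (ex_intro _ l (ex_intro _ x (And3 I lx erefl))).
rewrite dotE => /eqP; rewrite sqrf_eq0 normr_eq0; apply/negP.
by apply: inc_neq0; case: lx.
Qed.

Lemma espaceTE u : espace setT u.
Proof.
have [Vp xp] := projP ip (espace_subspace setT) (@espace_closed setT) u.
move: (proj ip (espace setT) u) Vp xp => p Vp xp.
suff -> : u = p by [].
apply/eqP; rewrite -subr_eq0; apply/eqP/orth_eigen0 => l x lx.
by apply: xp; exact: espace_eigen lx.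
Qed.

Let pos : set R := [set l | 0 < l].
Let neg : set R := [set l | l < 0].

Let pos_neg l : pos l -> neg l -> False.
Proof. by move=> /= l0 /lt_trans/(_ l0); rewrite ltxx. Qed.

(** Invertibility excludes the eigenvalue 0, so every eigenvector is positive or negative, and the
    defect of the sum is orthogonal to all of them. *)
Lemma projD_pos_neg u : proj ip (espace pos) u + proj ip (espace neg) u = u.
Proof.
have [Vp xp] := projP ip (espace_subspace pos) (@espace_closed pos) u.
have [Vq xq] := projP ip (espace_subspace neg) (@espace_closed neg) u.
move: (proj ip (espace pos) u) (proj ip (espace neg) u) Vp Vq xp xq => p q Vp Vq xp xq.
apply/eqP; rewrite eq_sym -subr_eq0; apply/eqP/orth_eigen0 => l x lx.
have := eigenvalue_neq0 lx; rewrite neq_lt => /orP[l0|l0].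
  have Vx : espace neg (inc x) by exact: espace_eigen lx.
  rewrite opprD addrA addrAC dotBl (xq _ Vx) sub0r.
  by rewrite (espace_orth pos_neg Vp Vx) oppr0.
have Vx : espace pos (inc x) by exact: espace_eigen lx.
rewrite opprD addrA dotBl (xp _ Vx) sub0r.
by rewrite dotC (espace_orth pos_neg Vx Vq) oppr0.
Qed.

Lemma proj_incT I u : proj ip (espace I) (inc (T u)) = inc (T (proj ip (espace I) u)).
Proof.
have [Vp xp] := projP ip (espace_subspace I) (@espace_closed I) u.
apply: proj_unique; [exact: espace_subspace|exact: espace_closed|exact: espaceT|].
move: (proj ip _ u) Vp xp => p Vp xp v Vv.
by rewrite -!bdopB inverse_sym xp//; exact: espaceT.
Qed.

(** For orthogonal p and q, |p - q| = |p + q|, which gives the bound 1. The opaque existence proof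
    leaves [sgnE] as the only access to the operator. *)
Lemma sgn_exists : {S : 'L(E0, E0) |
  forall u, S u = proj ip (espace pos) u - proj ip (espace neg) u}.
Proof.
have bl : (fun u => proj ip (espace pos) u - proj ip (espace neg) u)
    \in @bounded_linear R E0 E0.
  apply/bounded_linearP; split=> [c x y|].
    rewrite !proj_lin//; try exact: espace_closed; try exact: espace_subspace.
    by rewrite scalerBr opprD addrACA.
  exists 1 => u; rewrite mul1r /= -ler_sqr ?nnegrE//.
  have [Vp _] := projP ip (espace_subspace pos) (@espace_closed pos) u.
  have [Vq _] := projP ip (espace_subspace neg) (@espace_closed neg) u.
  have := projD_pos_neg u.
  move: (proj ip (espace pos) u) (proj ip (espace neg) u) Vp Vq => p q Vp Vq <-.
  by rewrite (norm_sqrB ip) (norm_sqrD ip) (espace_orth pos_neg Vp Vq) mulr0 subr0 addr0.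
by exists (MkBdop bl).
Qed.

Definition sgn : 'L(E0, E0) := sval sgn_exists.

Lemma sgnE u : sgn u = proj ip (espace pos) u - proj ip (espace neg) u.
Proof. exact: (svalP sgn_exists). Qed.

Lemma sgn_pos u : espace pos u -> sgn u = u.
Proof.
move=> Vu; rewrite sgnE.
have pu : proj ip (espace pos) u = u.
  apply: proj_unique => //; [exact: espace_subspace|exact: espace_closed|].
  by move=> v _; rewrite subrr dot0.
rewrite pu; suff -> : proj ip (espace neg) u = 0 by rewrite subr0.
by apply: (addrI u); rewrite addr0 -[in RHS](projD_pos_neg u) pu.
Qed.

Lemma sgn_neg u : espace neg u -> sgn u = - u.
Proof.
move=> Vu; rewrite sgnE.
have pu : proj ip (espace neg) u = u.
  apply: proj_unique => //; [exact: espace_subspace|exact: espace_closed|].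
  by move=> v _; rewrite subrr dot0.
rewrite pu; suff -> : proj ip (espace pos) u = 0 by rewrite sub0r.
by apply: (addIr u); rewrite add0r -[in RHS](projD_pos_neg u) pu.
Qed.

Lemma sgnK u : sgn (sgn u) = u.
Proof.
have [Vp _] := projP ip (espace_subspace pos) (@espace_closed pos) u.
have [Vq _] := projP ip (espace_subspace neg) (@espace_closed neg) u.
rewrite [in sgn u]sgnE bdopB; have := projD_pos_neg u.
move: (proj ip (espace pos) u) (proj ip (espace neg) u) Vp Vq => p q Vp Vq <-.
by rewrite sgn_pos// sgn_neg// opprK.
Qed.

Lemma sgn_sym u v : ip (sgn u) v = ip u (sgn v).
Proof.
rewrite !sgnE dotBl dotBr; congr (_ - _); apply: proj_sym;
  by [exact: espace_subspace|exact: espace_closed].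
Qed.

Lemma norm_sgn u : `|sgn u| = `|u|.
Proof.
by apply/eqP; rewrite -(@eqrXn2 _ 2)// -!(dotE ip) sgn_sym sgnK.
Qed.

Lemma sgn_incT u : sgn (inc (T u)) = inc (T (sgn u)).
Proof. by rewrite !sgnE !proj_incT !bdopB. Qed.

Lemma sgn_eigen l x : eigen l x -> sgn (inc x) = Num.sg l *: inc x.
Proof.
move=> lx; have := eigenvalue_neq0 lx; rewrite neq_lt => /orP[l0|l0].
  rewrite sgn_neg; last exact: espace_eigen lx.
  by rewrite ltr0_sg// scaleN1r.
rewrite sgn_pos; last exact: espace_eigen lx.
by rewrite gtr0_sg// scale1r.
Qed.

Lemma proj_pos u : proj ip (espace pos) u = 2^-1 *: (u + sgn u).
Proof.
rewrite sgnE; have := projD_pos_neg u.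
move: (proj ip (espace pos) u) (proj ip (espace neg) u) => p q <-.
by rewrite addrACA subrr addr0 -mulr2n -[p *+ 2]scaler_nat scalerA mulVf// scale1r.
Qed.

Lemma proj_neg u : proj ip (espace neg) u = 2^-1 *: (u - sgn u).
Proof.
rewrite sgnE; have := projD_pos_neg u.
move: (proj ip (espace pos) u) (proj ip (espace neg) u) => p q <-.
rewrite opprB addrC addrA subrK -mulr2n -[q *+ 2]scaler_nat scalerA mulVf//.
by rewrite scale1r.
Qed.

(** The density is in the stronger norm of [E1]: approximate A x in [E0] by eigenvectors and apply
    the inverse, which is bounded into [E1] and only rescales each eigenvector. *)
Lemma eigen_dense x : closure (lin_span [set y | exists l, eigen l y]) x.
Proof.
apply/closureP => e e0; have /closureP Vx : closure (lin_span (eset setT)) (A x) by exact: espaceTE.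
have T1 : 0 < opnorm T + 1 by rewrite ltr_wpDl ?opnorm_ge0.
have [_ [n [f [c [fe ->]]]] d] := Vx _ (divr_gt0 e0 T1).
exists (T (\sum_i c i *: f i)).
  have [g gP] : exists g : 'I_n -> R * E1, forall i, eigen (g i).1 (g i).2 /\ f i = inc (g i).2.
    suff H i : exists g, eigen g.1 g.2 /\ f i = inc g.2.
      by exists (fun i => projT1 (cid (H i))) => i; case: cid.
    by have [l [y [_ ly ->]]] := fe i; exists (l, y).
  exists n, (fun i => (g i).2), (fun i => c i / (g i).1); split.
    by move=> i; exists (g i).1; have [] := gP i.
  rewrite linear_sum; apply: eq_bigr => i _; have [gi ->] := gP i.
  rewrite linearZ /= [in RHS](eigen_T gi) scalerA -mulrA mulVf ?mulr1//.
  exact: eigenvalue_neq0 gi.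
rewrite -{1}[x]AK -bdopB (le_lt_trans (opnorm_le _ _))//.
move: d; rewrite ltr_pdivlMr//; apply: le_lt_trans; rewrite mulrC.
by rewrite ler_wpM2l// lerDl.
Qed.

End SpectralTheorem.

(** * Energies *)

Lemma closure_ge0 (R : realType) (E : normedModType R) (V : set E) (f : E -> R) x :
  f y @[y --> x] --> f x -> (forall v, V v -> 0 <= f v) -> closure V x -> 0 <= f x.
Proof.
move=> fx fV Vx; rewrite leNgt; apply/negP => fx0.
have /Vx[y [Vy]] : \forall y \near x, f y < 0 by exact: cvgr_lt fx _ fx0.
by rewrite /= ltNge fV.
Qed.

(** The closures are taken one variable at a time, so separate continuity is enough. *)
Lemma closure2_ge0 (R : realType) (E F : normedModType R) (V : set E) (W : set F)
  (f : E -> F -> R) :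
  (forall x y, f u y @[u --> x] --> f x y) ->
  (forall x y, f x v @[v --> y] --> f x y) ->
  (forall x y, V x -> W y -> 0 <= f x y) ->
  forall x y, closure V x -> closure W y -> 0 <= f x y.
Proof.
move=> f1 f2 f0 x y Vx Wy; apply: (closure_ge0 (f1 x y)) Vx => u Vu.
by apply: (closure_ge0 (f2 u y)) Wy => v; exact: f0.
Qed.

Section Bilinear.
Context {R : realType} (E F : lmodType R).

Definition bilinear (Y : E -> F -> R) :=
  (forall a x x' y, Y (a *: x + x') y = a * Y x y + Y x' y) /\
  (forall a x y y', Y x (a *: y + y') = a * Y x y + Y x y').

(** The off-diagonal block form on the product: on the diagonal it is 2 Y x y, so a bound for
    quadratic forms becomes a bound for Y. *)
Definition symmetrize (Y : E -> F -> R) (z z' : E * F) : R :=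
  Y z.1 z'.2 + Y z'.1 z.2.

Lemma symbil_symmetrize Y : bilinear Y -> symbil (symmetrize Y).
Proof.
move=> [Yl Yr]; split=> [z z'|a z z' z'']; first by rewrite /symmetrize addrC.
by rewrite /symmetrize /= Yl Yr; ring.
Qed.

End Bilinear.

Lemma bilinearB (R : realType) (E F : normedModType R) (Y : E -> F -> R) x x' y :
  bilinear Y -> Y (x - x') y = Y x y - Y x' y.
Proof.
move=> [Yl _]; rewrite addrC -scaleN1r Yl; ring.
Qed.

Lemma bilinear_flip (R : realType) (E F : lmodType R) (Y : E -> F -> R) :
  bilinear Y -> bilinear (fun y x => Y x y).
Proof. by case. Qed.

Lemma bilinear_cvg (R : realType) (E F : normedModType R) (Y : E -> F -> R) m x y :
  bilinear Y -> (forall x y, `|Y x y| <= m * (`|x| * `|y|)) ->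
  Y u y @[u --> x] --> Y x y.
Proof.
move=> Yb Ym; have m0 : 0 <= `|m| * `|y| by rewrite mulr_ge0.
have m1 : 0 < `|m| * `|y| + 1 by rewrite ltr_wpDl.
apply/cvgrPdist_le => e e0.
have := @cvg_id _ (nbhs x); move=> /cvgrPdist_le/(_ _ (divr_gt0 e0 m1)).
apply: filterS => u; rewrite ler_pdivlMr// => xu.
rewrite -(bilinearB _ _ _ Yb) (le_trans (Ym _ _))//; apply: le_trans xu.
rewrite mulrCA ler_wpM2l// (@le_trans _ _ (`|m| * `|y|))//.
  by rewrite ler_wpM2r// ler_norm.
by rewrite lerDl.
Qed.

Section EigenCoordinates.
Context {R : realType} {E0 : completeNormedModType R} {E1 : normedModType R}.
Context {ip : inner E0} {inc : 'L(E1, E0)}.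
Hypotheses (inc_inj : injective inc)
  (inc_compact : forall (f : nat -> E1) M, (forall n, `|f n| <= M) ->
     exists (G : set_system nat) (z : E0),
       [/\ ProperFilter G, \oo `<=` G & inc (f n) @[n --> G] --> z]).

Section One.
Variable A : selfadjoint ip inc.
Local Notation T := (sa_inv A).
Local Notation S := (sgn inc_inj inc_compact A).

(** Symmetry of |A|: the sign is symmetric and commutes with the inverse of A. *)
Lemma abs_sym x y : ip (S (A x)) (inc y) = ip (inc x) (S (A y)).
Proof.
have -> : ip (inc x) (S (A y)) = ip (inc x) (A (T (S (A y)))) by rewrite sa_invK.
by rewrite -sa_sym -sgn_incT sa_opK sgn_sym.
Qed.

Variables (n : nat) (l : 'I_n -> R) (e : 'I_n -> E1).
Hypothesis (le_eigen : forall i, eigen A (l i) (e i)).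

Definition comb (c : 'I_n -> R) : E1 := \sum_i c i *: e i.

Definition absl (c : 'I_n -> R) : 'I_n -> R := fun i => `|l i| * c i.

Lemma comb_lin a c c' : comb (a *: c + c') = a *: comb c + comb c'.
Proof.
rewrite /comb scaler_sumr -big_split; apply: eq_bigr => i _ /=.
by rewrite scalerA -scalerDl.
Qed.

Lemma combZ a c : comb (a *: c) = a *: comb c.
Proof. by rewrite /comb scaler_sumr; apply: eq_bigr => i _; rewrite scalerA. Qed.

Lemma inc_comb c : inc (comb c) = \sum_i c i *: inc (e i).
Proof. by rewrite linear_sum; apply: eq_bigr => i _; rewrite linearZ. Qed.

Lemma abs_comb c : S (A (comb c)) = inc (comb (absl c)).
Proof.
rewrite inc_comb /comb !linear_sum; apply: eq_bigr => i _.
rewrite linearZ linearZ /= (proj2 (le_eigen i)) bdopZ.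
rewrite (sgn_eigen inc_inj inc_compact (le_eigen i)) !scalerA /absl.
by rewrite [in RHS]normrEsg; congr (_ *: _); ring.
Qed.

(** Pulled back to coefficients, |A| becomes the bounded diagonal map [absl]. The eigenvectors may
    be linearly dependent, so this form is only semidefinite, as [form_comparison] allows. *)
Definition gram (c c' : 'I_n -> R) : R := ip (inc (comb c)) (inc (comb c')).

Lemma gram_symbil : symbil gram.
Proof.
split=> [c c'|a c c' c'']; first exact: dotC.
by rewrite /gram comb_lin bdopD bdopZ dotDl.
Qed.

Lemma gram_ge0 c : 0 <= gram c c. Proof. exact: dot_ge0. Qed.

Lemma gram_absl c c' : gram (absl c) c' = gram c (absl c').
Proof. by rewrite /gram -!abs_comb abs_sym. Qed.

(* Eigenvectors of different eigenvalues are orthogonal, so the weight can be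
   split as a product of square roots. *)
Lemma gram_weight_ge0 (w : R -> R) c : (forall i, 0 <= w (l i)) ->
  0 <= gram (fun i => w (l i) * c i) c.
Proof.
move=> w0; pose d i := Num.sqrt (w (l i)) * c i.
suff -> : gram (fun i => w (l i) * c i) c = gram d d by exact: gram_ge0.
rewrite /gram !inc_comb !dot_suml; apply: eq_bigr => i _.
rewrite !dot_sumr !mulr_sumr; apply: eq_bigr => j _; rewrite /d.
have [lij|lij] := eqVneq (l i) (l j).
  by rewrite lij -{1}(sqr_sqrtr (w0 j)); ring.
by rewrite (eigen_orth (le_eigen i) (le_eigen j) lij) !mulr0.
Qed.

Lemma gram_absl_ge0 c : 0 <= gram (absl c) c.
Proof. exact: (gram_weight_ge0 (w := fun t => `|t|)). Qed.

(** The sum of the |l i| dominates each of them, so the weight |t| (k - |t|) is nonnegative at every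
    eigenvalue. *)
Lemma gram_absl_bound : exists k, 0 <= k /\
  forall c, gram (absl c) (absl c) <= k * gram (absl c) c.
Proof.
exists (\sum_i `|l i|); split; first exact: sumr_ge0.
move=> c; rewrite -subr_ge0; set k := \sum_i _.
have := gram_weight_ge0 (w := fun t => `|t| * (k - `|t|)) c.
have -> : gram (fun i => `|l i| * (k - `|l i|) * c i) c
    = k * gram (absl c) c - gram (absl c) (absl c).
  have -> : (fun i => `|l i| * (k - `|l i|) * c i) = - 1 *: absl (absl c) + k *: absl c.
    apply/funext => i.
    have -> : (- 1 *: absl (absl c) + k *: absl c) i
      = - 1 * (`|l i| * (`|l i| * c i)) + k * (`|l i| * c i) by [].
    ring.
  rewrite gram_symbil.2 gram_absl mulN1r addrC; congr (_ - _).
  by rewrite /gram combZ bdopZ dotZl.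
apply=> i; rewrite mulr_ge0// subr_ge0 /k (bigD1 i)//= lerDl.
exact: sumr_ge0.
Qed.

End One.

Lemma lin_span_comb (A : selfadjoint ip inc) x :
  lin_span [set y | exists l, eigen A l y] x ->
  exists n (l : 'I_n -> R) (e : 'I_n -> E1) c,
    (forall i, eigen A (l i) (e i)) /\ x = comb e c.
Proof.
move=> [n [e [c [eA ->]]]].
by exists n, (fun i => projT1 (cid (eA i))), e, c; split=> // i; case: cid.
Qed.

Variables A B : selfadjoint ip inc.
Local Notation SA := (sgn inc_inj inc_compact A).
Local Notation SB := (sgn inc_inj inc_compact B).

(* [form_comparison] with [P = |A| + |B|] in coordinates along eigenvectors, where
   [P] is bounded. *)
Lemma energy_comparison_comb (Y : E1 -> E1 -> R) (m c : R)
  n (l : 'I_n -> R) (e : 'I_n -> E1) n' (l' : 'I_n' -> R) (e' : 'I_n' -> E1) :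
  (forall i, eigen A (l i) (e i)) -> (forall i, eigen B (l' i) (e' i)) ->
  bilinear Y -> 0 <= c -> 0 <= m ->
  (forall x y, `|Y x y| <= m * (`|x| * `|y|)) ->
  (forall x y x' y', inc x' = SA (A x) -> inc y' = SB (B y) ->
    Y x y' + Y x' y <= c * (`|A x| ^+ 2 + `|B y| ^+ 2)) ->
  forall a b, 2 * Y (comb e a) (comb e' b) <=
    c * (ip (SA (A (comb e a))) (inc (comb e a))
         + ip (SB (B (comb e' b))) (inc (comb e' b))).
Proof.
move=> eA eB Yb c0 m0 Ym Yc a b.
pose Z : lmodType R := (('I_n -> R) * ('I_n' -> R))%type.
pose grA := @gram n e; pose grB := @gram n' e'.
pose g (z z' : Z) := grA z.1 z'.1 + grB z.2 z'.2.
pose P (z : Z) : Z := (absl l z.1, absl l' z.2).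
pose Q := symmetrize (fun (a : 'I_n -> R) (b : 'I_n' -> R) => Y (comb e a) (comb e' b)).
have gA : symbil grA by exact: gram_symbil.
have gB : symbil grB by exact: gram_symbil.
have [kA [kA0 gkA]] := gram_absl_bound eA.
have [kB [kB0 gkB]] := gram_absl_bound eB.
pose tA := opnorm (sa_inv A); pose tB := opnorm (sa_inv B); pose ni := opnorm inc.
have TA0 : 0 <= tA by exact: opnorm_ge0.
have TB0 : 0 <= tB by exact: opnorm_ge0.
have o0 : 0 <= ni by exact: opnorm_ge0.
have xA x : `|x| <= tA * `|A x| by rewrite -{1}[x](sa_opK A) opnorm_le.
have xB x : `|x| <= tB * `|B x| by rewrite -{1}[x](sa_opK B) opnorm_le.
have nA z : grA (absl l z) (absl l z) = `|A (comb e z)| ^+ 2.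
  by rewrite /grA /gram -!(abs_comb eA) dotE norm_sgn.
have nB z : grB (absl l' z) (absl l' z) = `|B (comb e' z)| ^+ 2.
  by rewrite /grB /gram -!(abs_comb eB) dotE norm_sgn.
have rA z : grA (absl l z) z <= ni * tA * grA (absl l z) (absl l z).
  rewrite nA /grA /gram -(abs_comb eA).
  rewrite (le_trans (ler_norm _))// (le_trans (dot_CS _ _ _))// norm_sgn.
  rewrite mulrC expr2 mulrA ler_wpM2r// (le_trans (opnorm_le _ _))// -/ni -mulrA.
  by rewrite ler_wpM2l.
have rB z : grB (absl l' z) z <= ni * tB * grB (absl l' z) (absl l' z).
  rewrite nB /grB /gram -(abs_comb eB).
  rewrite (le_trans (ler_norm _))// (le_trans (dot_CS _ _ _))// norm_sgn.
  rewrite mulrC expr2 mulrA ler_wpM2r// (le_trans (opnorm_le _ _))// -/ni -mulrA.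
  by rewrite ler_wpM2l.
have pA z : 0 <= grA (absl l z) z by exact: (gram_absl_ge0 (A := A)).
have pB z : 0 <= grB (absl l' z) z by exact: (gram_absl_ge0 (A := B)).
have qA z : 0 <= grA z z by exact: gram_ge0.
have qB z : 0 <= grB z z by exact: gram_ge0.
(* [form_comparison] takes a single m for two hypotheses: the first two summands bound the energies
   by the squared norms of A u and B v, the last one bounds Y. *)
pose M := ni * tA + ni * tB + m * (tA * tB).
have oA0 : 0 <= ni * tA by rewrite mulr_ge0.
have oB0 : 0 <= ni * tB by rewrite mulr_ge0.
have mAB0 : 0 <= m * (tA * tB) by rewrite !mulr_ge0.
have M0 : 0 <= M by rewrite !addr_ge0.
have main : Q (a, b) (a, b) <= c * g (P (a, b)) (a, b).
  apply: (@form_comparison R Z g Q P (kA + kB) M c) => //.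
  - split=> [z z'|r z z' z'']; first by rewrite /g gA.1 gB.1.
    by rewrite /g gA.2 gB.2; ring.
  - apply: symbil_symmetrize; split=> r x x' y; rewrite comb_lin; first exact: Yb.1.
    exact: Yb.2.
  - by move=> r z z'; congr pair; apply/funext => i; rewrite /= /absl mulrDr mulrCA.
  - move=> z z'; rewrite /g /P /grA /grB /=.
    by rewrite (gram_absl eA) (gram_absl eB).
  - by move=> z; exact: addr_ge0 (qA z.1) (qB z.2).
  - by move=> z; exact: addr_ge0 (pA z.1) (pB z.2).
  - exact: addr_ge0.
  - move=> z; rewrite /g mulrDr; apply: lerD.
      by apply: le_trans (gkA _) _; rewrite ler_wpM2r// lerDl.
    by apply: le_trans (gkB _) _; rewrite ler_wpM2r// lerDr.
  - move=> z; rewrite /g mulrDr; apply: lerD.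
      by apply: le_trans (rA _) _; rewrite ler_wpM2r// /M -addrA lerDl addr_ge0.
    apply: le_trans (rB _) _; rewrite ler_wpM2r// /M.
    by rewrite [ni * tA + _]addrC -addrA lerDl addr_ge0.
  - move=> z; rewrite /g /P /= nA nB /Q /symmetrize.
    set u := comb e z.1; set v := comb e' z.2.
    rewrite -mulr2n -[_ *+ 2]mulr_natl normrM normr_nat.
    have h1 : `|Y u v| <= m * (tA * tB) * (`|A u| * `|B v|).
      apply: le_trans (Ym u v) _; rewrite -mulrA ler_wpM2l// mulrACA.
      by rewrite ler_pM.
    have h2 : m * (tA * tB) * (`|A u| * `|B v|) <= M * (`|A u| * `|B v|).
      by rewrite ler_wpM2r ?mulr_ge0// /M lerDr addr_ge0.
    have h3 : 2 * (`|A u| * `|B v|) <= `|A u| ^+ 2 + `|B v| ^+ 2.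
      have := sqr_ge0 (`|A u| - `|B v|).
      by move: (`|A u|) (`|B v|) => p q; lra.
    apply: le_trans (ler_wpM2l M0 h3); rewrite mulrCA ler_wpM2l//.
    exact: le_trans h1 h2.
  - move=> z; rewrite /g /P /= nA nB /Q /symmetrize /=.
    by apply: Yc; rewrite ?(abs_comb eA)
      ?(abs_comb eB).
move: main; rewrite /Q /symmetrize /g /P /= /grA /grB /gram.
rewrite -(abs_comb eA) -(abs_comb eB).
by rewrite -mulr2n -[_ *+ 2]mulr_natl.
Qed.

Lemma energy_cvg (C : selfadjoint ip inc) x :
  ip (sgn inc_inj inc_compact C (C y)) (inc y) @[y --> x] -->
  ip (sgn inc_inj inc_compact C (C x)) (inc x).
Proof.
have idx := @cvg_id _ (nbhs x).
by apply: cvg_dot; [apply: bdop_cvg; exact: bdop_cvg|exact: bdop_cvg].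
Qed.

Lemma energy_ge0 (C : selfadjoint ip inc) x :
  0 <= ip (sgn inc_inj inc_compact C (C x)) (inc x).
Proof.
pose f y := ip (sgn inc_inj inc_compact C (C y)) (inc y).
apply: (@closure_ge0 _ _ _ f x (@energy_cvg C x) _
  (@eigen_dense _ _ _ _ _ inc_inj inc_compact C x)).
move=> _ /lin_span_comb[n [l [e [c [eC ->]]]]].
rewrite /f (abs_comb eC).
exact: (gram_absl_ge0 eC).
Qed.

(** The two slots carry independent operators, which serves both Loewner-Heinz (A = B) and the
    Lyapunov equation. The vectors x' and y' stand for |A| x and |B| y, which lie in the domain only
    for some x and y, such as combinations of eigenvectors. *)
Lemma energy_comparison (Y : E1 -> E1 -> R) (m c : R) :
  bilinear Y -> 0 <= c -> 0 <= m ->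
  (forall x y, `|Y x y| <= m * (`|x| * `|y|)) ->
  (forall x y x' y', inc x' = SA (A x) -> inc y' = SB (B y) ->
    Y x y' + Y x' y <= c * (`|A x| ^+ 2 + `|B y| ^+ 2)) ->
  forall x y, 2 * Y x y <=
    c * (ip (SA (A x)) (inc x) + ip (SB (B y)) (inc y)).
Proof.
move=> Yb c0 m0 Ym Yc x y; rewrite -subr_ge0.
pose f x y := c * (ip (SA (A x)) (inc x) + ip (SB (B y)) (inc y)) - 2 * Y x y.
apply: (@closure2_ge0 _ _ _ _ _ f _ _ _ x y (@eigen_dense _ _ _ _ _ inc_inj inc_compact A x)
  (@eigen_dense _ _ _ _ _ inc_inj inc_compact B y)) => {x y} [x y|x y|x y]; rewrite /f.
- apply: cvgB.
    by apply: cvgMl_tmp; apply: cvgD; [exact: energy_cvg|exact: cvg_cst].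
  by apply: cvgMl_tmp; exact: (@bilinear_cvg _ _ _ Y m x y Yb Ym).
- apply: cvgB.
    by apply: cvgMl_tmp; apply: cvgD; [exact: cvg_cst|exact: energy_cvg].
  apply: cvgMl_tmp; apply: (@bilinear_cvg _ _ _ (fun v u => Y u v) m y x (bilinear_flip Yb)).
  by move=> u v; rewrite [`|u| * _]mulrC.
- move=> /lin_span_comb[n [l [e [a [eA ->]]]]] /lin_span_comb[n' [l' [e' [b [eB ->]]]]].
  by rewrite subr_ge0; exact: (energy_comparison_comb eA eB Yb c0 m0).
Qed.

End EigenCoordinates.

Lemma dotD (R : realType) (E : normedModType R) (ip : inner E) x y v :
  ip (x + y) v = ip x v + ip y v.
Proof. by rewrite -[x]scale1r dotDl scale1r mul1r. Qed.

(** * The Lyapunov estimate for the difference of two signs *)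

Section SignDifference.
Context {R : realType} {E0 : completeNormedModType R} {E1 : normedModType R}.
Context {ip : inner E0} {inc : 'L(E1, E0)}.
Hypotheses (inc_inj : injective inc)
  (inc_compact : forall (f : nat -> E1) M, (forall n, `|f n| <= M) ->
     exists (G : set_system nat) (z : E0),
       [/\ ProperFilter G, \oo `<=` G & inc (f n) @[n --> G] --> z]).

Local Notation S A := (sgn inc_inj inc_compact A).

(** The restriction of the sign to the domain, written as a conjugate by A so that it takes values
    in [E1] by construction. *)
Definition sgn1 (A : selfadjoint ip inc) (x : E1) : E1 := sa_inv A (S A (A x)).

Definition energy (A : selfadjoint ip inc) (x : E1) : R := ip (S A (A x)) (inc x).

Lemma inc_sgn1 (A : selfadjoint ip inc) x : inc (sgn1 A x) = S A (inc x).
Proof. by rewrite /sgn1 -sgn_incT sa_opK. Qed.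

Lemma sgn1_lin (A : selfadjoint ip inc) c x y :
  sgn1 A (c *: x + y) = c *: sgn1 A x + sgn1 A y.
Proof. by rewrite /sgn1 !bdopD !bdopZ. Qed.

Lemma op_sgn1 (A : selfadjoint ip inc) x : A (sgn1 A x) = S A (A x).
Proof. exact: sa_invK. Qed.

Lemma energy_sgn1 (A : selfadjoint ip inc) x : energy A (sgn1 A x) = energy A x.
Proof. by rewrite /energy op_sgn1 inc_sgn1 sgnK -sgn_sym. Qed.

Lemma mul2_le_sqr (a b c : R) : 0 <= c -> 2 * (c * (a * b)) <= c * (a ^+ 2 + b ^+ 2).
Proof.
move=> c0; rewrite mulrCA ler_wpM2l//; have := sqr_ge0 (a - b); lra.
Qed.

Lemma form_le_energy (A : selfadjoint ip inc) (Q : E1 -> E1 -> R) (m k : R) :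
  symbil Q -> 0 <= k -> 0 <= m -> (forall x y, `|Q x y| <= m * (`|x| * `|y|)) ->
  (forall x y y', inc y' = S A (A y) -> Q x y' <= k * (`|A x| * `|A y|)) ->
  forall x, Q x x <= k * energy A x.
Proof.
move=> Qb k0 m0 Qm Qk x.
have Yb : bilinear Q.
  by split=> [|a u v w]; [exact: Qb.2|rewrite Qb.1 Qb.2 !(Qb.1 _ u)].
have EC := @energy_comparison _ _ _ _ _ inc_inj inc_compact A A Q m k Yb k0 m0 Qm.
suff : 2 * Q x x <= k * (energy A x + energy A x) by lra.
apply: EC => u v u' v' uu vv; apply: le_trans (mul2_le_sqr _ _ k0).
rewrite mulr_natl mulr2n; apply: lerD; first exact: Qk.
by rewrite Qb.1 [`|A u| * _]mulrC; exact: Qk.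
Qed.

(* [D = S B - S A] solves the Lyapunov equation [|B| D + D |A| = E - (S B) E (S A)]
   with [E = B - A]. *)
Lemma energy_sgn_difference (A B : selfadjoint ip inc) (d t : R) :
  0 <= d -> 0 <= t -> (forall x, `|B x - A x| <= d * `|x|) ->
  (forall x, `|x| <= t * `|A x|) ->
  forall x, energy B (sgn1 B x - sgn1 A x) <= (d * t) ^+ 2 * energy A x.
Proof.
move=> d0 t0 BA xA x; set c := d * t.
have c0 : 0 <= c by rewrite mulr_ge0.
pose D x := sgn1 B x - sgn1 A x.
have D_lin a u v : D (a *: u + v) = a *: D u + D v.
  by rewrite /D !sgn1_lin scalerBr opprD addrACA.
have incD u : inc (D u) = S B (inc u) - S A (inc u) by rewrite bdopB !inc_sgn1.
(* With this choice, Y(u, |B| v) + Y(|A| u, v) is the pairing of (|B| D + D |A|) u with |B| v, so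
   the Lyapunov equation can be inserted. *)
pose Y u v := ip (inc (D u)) (S B (B v)).
have Yb : bilinear Y.
  split=> [a u u' v|a u v v']; rewrite /Y; first by rewrite D_lin bdopD bdopZ dotDl.
  by rewrite !bdopD !bdopZ dotDr.
have Ym u v : `|Y u v| <= 2 * opnorm inc * opnorm B * (`|u| * `|v|).
  rewrite (le_trans (dot_CS _ _ _))// norm_sgn.
  have -> : 2 * opnorm inc * opnorm B * (`|u| * `|v|) =
    2 * (opnorm inc * `|u|) * (opnorm B * `|v|) by ring.
  rewrite ler_pM// ?opnorm_le// incD (le_trans (ler_normB _ _))// !norm_sgn.
  by rewrite mulr_natl mulr2n lerD// opnorm_le.
have m0 : 0 <= 2 * opnorm inc * opnorm B by rewrite !mulr_ge0 ?opnorm_ge0.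
have Yc u v u' v' : inc u' = S A (A u) -> inc v' = S B (B v) ->
    Y u v' + Y u' v <= c * (`|A u| ^+ 2 + `|B v| ^+ 2).
  move=> uu vv; apply: le_trans (mul2_le_sqr _ _ c0).
  have -> : Y u v' = ip (S B (B (D u))) (S B (B v)).
    by rewrite /Y -vv -abs_sym.
  rewrite /Y -dotD incD uu sgnK.
  set s := sgn1 A u.
  have -> : S B (B (D u)) + (S B (S A (A u)) - A u) = (B u - A u) - S B (B s - A s).
    rewrite /D !bdopB op_sgn1 sgnK -/s [A s]op_sgn1.
    by rewrite opprB addrACA [RHS]addrACA; congr (_ + _); rewrite addrC.
  rewrite (le_trans (ler_norm _))// (le_trans (dot_CS _ _ _))// norm_sgn mulrA mulrA.
  rewrite ler_wpM2r// (le_trans (ler_normB _ _))// norm_sgn.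
  have h1 : `|B u - A u| <= c * `|A u|.
    by rewrite (le_trans (BA u))// /c -mulrA ler_wpM2l.
  have h2 : `|B s - A s| <= c * `|A u|.
    rewrite (le_trans (BA s))// /c -mulrA ler_wpM2l// (le_trans (xA s))//.
    by rewrite [A s]op_sgn1 norm_sgn.
  by rewrite -mulrA mulr_natl mulr2n lerD.
(* At y = a D x the form Y(x, y) is a times the energy of D x. The free scale a is then set to c^-1,
   which balances the two energies and yields the factor c^2; for c = 0, a = 1 suffices. *)
have H a : 2 * (a * energy B (D x)) <= c * (energy A x + a ^+ 2 * energy B (D x)).
  have := @energy_comparison _ _ _ _ _ inc_inj inc_compact A B Y _ c Yb c0 m0 Ym Yc x (a *: D x).
  rewrite -/(energy A x) /Y bdopZ bdopZ dotZr dotC -/(energy B (D x)).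
  by rewrite bdopZ dotZl dotZr -/(energy B (D x)) mulrA -expr2.
have [ce|cn] := eqVneq c 0.
  have := H 1; rewrite ce mul0r mul1r expr0n mul0r /=; lra.
have cp : 0 < c by rewrite lt_neqAle eq_sym cn.
have := H c^-1; rewrite -/(D x).
move: (energy A x) (energy B (D x)) => a b H1.
have := ler_wpM2l c0 H1.
have -> : c * (2 * (c^-1 * b)) = 2 * b by field.
have -> : c * (c * (a + c^-1 ^+ 2 * b)) = c ^+ 2 * a + b by field.
lra.
Qed.

End SignDifference.

(** * Interpolation *)

Section Truncation.
Context {R : realType} (h : growth R).
Implicit Types (x y z : nat -> R) (a b r s : R) (N : nat).

(** Finitely supported sequences lie in every space of the scale, and truncation increases none of
    the norms. *)
Definition trunc N x : nat -> R := fun n => if (n < N)%N then x n else 0.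

Lemma trunc_lin N c x y : trunc N (c *: x + y) = c *: trunc N x + trunc N y.
Proof.
apply/funext => n.
have -> : (c *: trunc N x + trunc N y) n = c * trunc N x n + trunc N y n by [].
by rewrite /trunc; case: ifP => // _; rewrite mulr0 addr0.
Qed.

Lemma psumSr s x y n : psum h s x y n.+1 = psum h s x y n + h n `^ s * x n * y n.
Proof. by rewrite /psum /series /= big_nat_recr. Qed.

Lemma psum0n s x y : psum h s x y 0 = 0.
Proof. by rewrite /psum /series /= big_geq. Qed.

Lemma psum_trunc s N x n : psum h s (trunc N x) (trunc N x) n <= psum h s x x N.
Proof.
have le1 k : psum h s (trunc N x) (trunc N x) k <= psum h s x x k.
  elim: k => [|k IH]; first by rewrite !psum0n.
  rewrite !psumSr lerD// /trunc; case: ifP => // _.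
  by rewrite mulr0 -mulrA mulr_ge0 ?powR_ge0// -expr2 sqr_ge0.
elim: n => [|n IH]; first by rewrite psum0n psum_ge0.
have [nN|Nn] := ltnP n N.
  by apply: le_trans (le1 _) _; exact: psum_nd.
by rewrite psumSr /trunc ltnNge Nn /= mulr0 addr0.
Qed.

Lemma trunc_wsummable s N x : trunc N x \in wsummable h s.
Proof. by have [] := wsummable_le (psum_trunc s N x). Qed.

Lemma ip_trunc s N x : ip h s (trunc N x) (trunc N x) = psum h s x x N.
Proof.
apply/le_anti/andP; split.
  by have [_] := wsummable_le (psum_trunc s N x).
apply: le_trans (psum_le_ip N (trunc_wsummable s N x)).
suff H k : (k <= N)%N -> psum h s x x k <= psum h s (trunc N x) (trunc N x) k by exact: H.
elim: k => [|k IH] kN; first by rewrite !psum0n.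
by rewrite !psumSr lerD ?IH ?(ltnW kN)// /trunc kN.
Qed.

Lemma trunc_cvg r (x : Hsp h r) : emb h r (trunc N x) @[N --> \oo] --> x.
Proof.
have cx : psum h r x x @ \oo --> ip h r x x by apply/wsummable_psum; exact: valP.
apply/cvgrPdist_le => e e0.
move/cvgrPdist_le : cx => /(_ (e ^+ 2)); rewrite exprn_gt0// => /(_ isT).
apply: filterS => N; rewrite ger0_norm ?subr_ge0 ?psum_le_ip//; last exact: valP.
move=> H; rewrite -ler_sqr ?nnegrE ?(ltW e0)// HnormE; apply: le_trans H.
have dE : seq_of (x - emb h r (trunc N x)) = seq_of x - trunc N x.
  by rewrite seqB embK// trunc_wsummable.
rewrite dE; suff bnd n : psum h r (seq_of x - trunc N x) (seq_of x - trunc N x) n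
    <= ip h r x x - psum h r x x N by have [] := wsummable_le bnd.
have dn k : (seq_of x - trunc N x) k = if (k < N)%N then 0 else x k.
  have -> : (seq_of x - trunc N x) k = x k - trunc N x k by [].
  by rewrite /trunc; case: ifP => _; rewrite ?subrr ?subr0.
have xr := valP x.
suff H : psum h r (seq_of x - trunc N x) (seq_of x - trunc N x) n
    <= psum h r x x (maxn n N) - psum h r x x N.
  by apply: le_trans H _; rewrite lerB// psum_le_ip.
elim: n => [|n IH]; first by rewrite psum0n max0n subrr.
rewrite psumSr !dn; have [nN|Nn] := ltnP n N.
  rewrite mulr0 addr0 (maxn_idPr nN); move: IH.
  by rewrite (maxn_idPr (ltnW nN)).
rewrite (maxn_idPl (leqW Nn)) psumSr; move: IH; rewrite (maxn_idPl Nn).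
by rewrite addrAC lerD2r.
Qed.

End Truncation.

Section Maps.
Context {R : realType} (h : growth R).
Implicit Types (a b r s : R).

Lemma weight_half a n :
  h n `^ (a + 1) = h n `^ a * (h n `^ 2^-1 * h n `^ 2^-1).
Proof. by rewrite -!weightD; congr (_ `^ _); field. Qed.

(** Norms of raw sequences allow one sequence to be measured in several spaces; the value is
    significant only under summability. *)
Definition nrm s (x : nat -> R) : R := Num.sqrt (ip h s x x).

Lemma nrm_ge0 s x : 0 <= nrm s x. Proof. exact: sqrtr_ge0. Qed.

Lemma nrm_sqr s x : x \in wsummable h s -> nrm s x ^+ 2 = ip h s x x.
Proof. by move=> xs; rewrite sqr_sqrtr// ip_sqr_ge0. Qed.

Lemma nrm_emb s x : x \in wsummable h s -> `|emb h s x| = nrm s x.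
Proof. by move=> xs; rewrite [LHS]/(Hnorm _) /Hnorm embK. Qed.

Lemma nrmE s (x : Hsp h s) : nrm s x = `|x|. Proof. by []. Qed.

Lemma nrmD s x y : x \in wsummable h s -> y \in wsummable h s ->
  nrm s (x + y) <= nrm s x + nrm s y.
Proof.
move=> xs ys; rewrite -!nrm_emb ?rpredD//.
have -> : emb h s (x + y) = emb h s x + emb h s y.
  by rewrite -[x in LHS]scale1r emb_lin// scale1r.
exact: ler_normD.
Qed.

Lemma nrmN s x : nrm s (- x) = nrm s x.
Proof.
rewrite /nrm /ip; congr (Num.sqrt (limn (series _))); apply/funext => n.
by have -> : (- x) n = - x n by []; ring.
Qed.

Lemma nrmB s x y : x \in wsummable h s -> y \in wsummable h s ->
  nrm s (x - y) <= nrm s x + nrm s y.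
Proof.
by move=> xs ys; rewrite -(nrmN s y); apply: nrmD => //; rewrite rpredN.
Qed.

Lemma nrm_le s x k : 0 <= k -> x \in wsummable h s ->
  (nrm s x <= k) = (ip h s x x <= k ^+ 2).
Proof. by move=> k0 xs; rewrite -nrm_sqr// ler_sqr ?nnegrE ?nrm_ge0. Qed.

Lemma nrm_le_sqr r s C x y : 0 <= C ->
  y \in wsummable h r -> x \in wsummable h s ->
  nrm r y <= C * nrm s x -> ip h r y y <= C ^+ 2 * ip h s x x.
Proof.
move=> C0 yr xs yx; rewrite -(nrm_sqr yr) -(nrm_sqr xs) -exprMn.
by rewrite ler_sqr ?nnegrE ?mulr_ge0 ?nrm_ge0.
Qed.

Lemma le_of_sqr (x k : R) : 0 <= k -> x ^+ 2 <= k ^+ 2 -> x <= k.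
Proof. by move=> k0; rewrite leNgt => xk; rewrite leNgt; apply: contra xk; nra. Qed.

(** Boundedness from H_s to H_r of a map whose declared spaces are H_p and H_q, tested on the common
    part of H_p and H_s. Such estimates chain without constructing restricted operators. *)
Definition maps (p q s r C : R) (f : Hsp h p -> Hsp h q) :=
  forall x : Hsp h p, seq_of x \in wsummable h s ->
    seq_of (f x) \in wsummable h r /\ nrm r (f x) <= C * nrm s x.

(** Truncations converge in H_p and f is continuous, so the images converge coordinatewise and
    [wsummable_fatou] carries the bound over. *)
Lemma maps_trunc p q s r C (f : 'L(Hsp h p, Hsp h q)) : 0 <= C ->
  (forall N (x : nat -> R), seq_of (f (emb h p (trunc N x))) \in wsummable h r /\
     nrm r (f (emb h p (trunc N x))) <= C * nrm s (trunc N x)) ->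
  maps s r C f.
Proof.
move=> C0 H x xs.
have fx k : f (emb h p (trunc N x)) k @[N --> \oo] --> f x k.
  by apply: cvg_coord; apply: bdop_cvg; exact: trunc_cvg.
suff H1 : \forall N \near \oo, seq_of (f (emb h p (trunc N x))) \in wsummable h r /\
    ip h r (f (emb h p (trunc N x))) (f (emb h p (trunc N x))) <= (C * nrm s x) ^+ 2.
  have [fr fle] := wsummable_fatou fx H1.
  by split=> //; rewrite nrm_le ?mulr_ge0 ?nrm_ge0.
  apply: filterE => N; have [fr fle] := H N x; split=> //.
  rewrite -nrm_le ?mulr_ge0 ?nrm_ge0//; apply: le_trans fle _.
  rewrite ler_wpM2l// nrm_le ?nrm_ge0 ?trunc_wsummable// nrm_sqr//.
  by rewrite ip_trunc psum_le_ip.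
Qed.

Lemma mapsW p q s r C C' (f : Hsp h p -> Hsp h q) : C <= C' ->
  maps s r C f -> maps s r C' f.
Proof.
move=> CC fm x xs; have [fr fle] := fm x xs; split=> //.
by rewrite (le_trans fle)// ler_wpM2r// nrm_ge0.
Qed.

(** [form_comparison] with g the form of exponent a and P the multiplication by h^(1/2): g(P x, x)
    and g(P x, P x) have exponents a + 1/2 and a + 1. The cut at N bounds P by h(N)^(1/2), a
    constant absent from the conclusion. *)
Lemma finseq_comparison a c m N (Q : (nat -> R) -> (nat -> R) -> R) :
  symbil Q -> 0 <= c -> 0 <= m ->
  (forall x, `|Q x x| <= m * psum h (a + 1) x x N) ->
  (forall x, Q x (fun n => h n `^ 2^-1 * x n) <= c * psum h (a + 1) x x N) ->
  forall x, Q x x <= c * psum h (a + 2^-1) x x N.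
Proof.
move=> Qb c0 m0 Qm Qc x.
pose g x y := psum h a x y N; pose P x : nat -> R := fun n => h n `^ 2^-1 * x n.
have gb : symbil g.
  split=> [u v|d u v w]; rewrite /g /psum /series /=.
    by apply: eq_bigr => i _; rewrite mulrAC.
  rewrite mulr_sumr -big_split; apply: eq_bigr => i _ /=.
  have -> : (d *: u + v) i = d * u i + v i by []; ring.
have e1 u : g (P u) u = psum h (a + 2^-1) u u N.
  by apply: eq_bigr => i _; rewrite weightD /P mulrA.
have e2 u : g (P u) (P u) = psum h (a + 1) u u N.
  by apply: eq_bigr => i _; rewrite weight_half /P; ring.
rewrite -e1; pose m1 := m + h 0 `^ (- 2^-1).
have w0 : 0 <= h 0 `^ (- 2^-1) by exact: powR_ge0.
have m10 : 0 <= m1 by rewrite addr_ge0.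
apply: (@form_comparison R _ g Q P (h N `^ 2^-1) m1 c) => //.
- move=> d u v; apply/funext => i.
  have -> : (d *: P u + P v) i = d * (h i `^ 2^-1 * u i) + h i `^ 2^-1 * v i by [].
  by rewrite /P; have -> : (d *: u + v) i = d * u i + v i by []; ring.
- by move=> u v; apply: eq_bigr => i _; rewrite /P; ring.
- by move=> u; exact: psum_ge0.
- by move=> u; rewrite e1; exact: psum_ge0.
- exact: powR_ge0.
- move=> u; rewrite e1 e2 /psum /series /= mulr_sumr.
  apply: ler_sum_nat => i /= iN.
  rewrite weight_half weightD.
  have -> : h i `^ a * (h i `^ 2^-1 * h i `^ 2^-1) * u i * u i =
    h i `^ 2^-1 * (h i `^ a * h i `^ 2^-1 * u i * u i) by ring.
  rewrite ler_wpM2r//.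
    by rewrite -mulrA -expr2 mulr_ge0 ?sqr_ge0 ?mulr_ge0 ?powR_ge0.
  apply: ge0_ler_powR; rewrite ?nnegrE ?invr_ge0 ?(ltW (growth_gt0 _ _))//.
  exact/growth_mono/ltnW.
- move=> u; rewrite e1 e2; apply: (@le_trans _ _ (h 0 `^ (- 2^-1) * psum h (a + 1) u u N)).
    have -> : - 2^-1 = (a + 2^-1) - (a + 1) :> R by field.
    have au : a + 2^-1 <= a + 1 by rewrite lerD2l; lra.
    rewrite -!ip_trunc; have [] := wsummableW au (trunc_wsummable h (a + 1) N u).
    by [].
  by rewrite ler_wpM2r ?psum_ge0// lerDr.
- move=> u; rewrite e2; apply: le_trans (Qm u) _.
  by rewrite ler_wpM2r ?psum_ge0// lerDl.
- by move=> u; rewrite e2; exact: Qc.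
Qed.

(* [form_comparison] with [P] the multiplication by [h^(1/2)], on truncations. *)
Lemma maps_interpolation_aux p q a b C (f : 'L(Hsp h p, Hsp h q)) : 0 <= C ->
  maps a b C f -> maps (a + 1) (b + 1) C f -> maps (a + 2^-1) (b + 2^-1) C f.
Proof.
move=> C0 f0 f1; apply: maps_trunc => // N x.
pose F x : nat -> R := f (emb h p (trunc N x)).
have tp s y := trunc_wsummable h s N y.
have Flin d u v : F (d *: u + v) = d *: F u + F v.
  by rewrite /F trunc_lin emb_lin// linearP.
have e0 u : seq_of (emb h p (trunc N u)) = trunc N u by apply: embK; exact: tp.
have F1 u : F u \in wsummable h (b + 1) /\ nrm (b + 1) (F u) <= C * nrm (a + 1) (trunc N u).
  by have := f1 (emb h p (trunc N u)); rewrite e0 => /(_ (tp _ u)).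
have F0 u : F u \in wsummable h b /\ nrm b (F u) <= C * nrm a (trunc N u).
  by have := f0 (emb h p (trunc N u)); rewrite e0 => /(_ (tp _ u)).
have F1s u : ip h (b + 1) (F u) (F u) <= C ^+ 2 * ip h (a + 1) (trunc N u) (trunc N u).
  by have [Fr Fle] := F1 u; exact: (nrm_le_sqr C0 Fr (tp _ u) Fle).
have F0s u : ip h b (F u) (F u) <= C ^+ 2 * ip h a (trunc N u) (trunc N u).
  by have [Fr Fle] := F0 u; exact: (nrm_le_sqr C0 Fr (tp _ u) Fle).
have bb : b + 2^-1 <= b + 1 by rewrite lerD2l; lra.
have Fh u : F u \in wsummable h (b + 2^-1) by have [] := wsummableW bb (F1 u).1.
split; first exact: Fh.
rewrite nrm_le ?mulr_ge0 ?nrm_ge0//; last exact: Fh.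
rewrite exprMn nrm_sqr// ip_trunc -/(F x).
have Qb : symbil (fun u v => ip h (b + 2^-1) (F u) (F v)).
  split=> [u v|d u v w]; first exact: ipC.
  by rewrite Flin ip_lin.
have C2 : 0 <= C ^+ 2 by rewrite sqr_ge0.
have w0 : 0 <= h 0 `^ (b + 2^-1 - (b + 1)) by exact: powR_ge0.
apply: (finseq_comparison (m := h 0 `^ (b + 2^-1 - (b + 1)) * C ^+ 2) Qb) => //.
- exact: mulr_ge0.
- move=> u; rewrite ger0_norm ?ip_sqr_ge0// -mulrA -ip_trunc.
  have [_ le1] := wsummableW bb (F1 u).1; apply: le_trans le1 _.
  by rewrite ler_wpM2l//; exact: F1s.
(* Here v = h^(1/2) u. Pairing F u in H_(b+1) with F v in H_b uses both endpoint bounds, and the H_a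
   norm of v equals the H_(a+1) norm of u. *)
- move=> u; set v := (fun n => _); have u0 := psum_ge0 h (a + 1) u N.
  apply: le_of_sqr; first by rewrite mulr_ge0.
  have e : (b + 1) + b = 2 * (b + 2^-1) by field.
  apply: le_trans (ip_mixed_CS e (F1 u).1 (F0 v).1) _.
  rewrite -[in leRHS]ip_trunc [leRHS]expr2; apply: ler_pM.
  - exact: ip_sqr_ge0 (F1 u).1.
  - exact: ip_sqr_ge0 (F0 v).1.
  - exact: F1s.
  - have -> : ip h (a + 1) (trunc N u) (trunc N u) = ip h a (trunc N v) (trunc N v).
      rewrite !ip_trunc; apply: eq_bigr => i _.
      by rewrite weight_half /v; ring.
    exact: F0s.
Qed.

(** Exponents enter through equations, so that numerals such as [3 / 2] can be used directly. *)
Lemma maps_interpolation p q a a1 ah b b1 bh C (f : 'L(Hsp h p, Hsp h q)) :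
  0 <= C -> a1 = a + 1 -> ah = a + 2^-1 -> b1 = b + 1 -> bh = b + 2^-1 ->
  maps a b C f -> maps a1 b1 C f -> maps ah bh C f.
Proof. by move=> C0 -> -> -> ->; exact: maps_interpolation_aux. Qed.

End Maps.

Lemma telescope_difference (V : zmodType) (a b c e : V) :
  a - e = a - b + (b - c) - (e - c).
Proof. by rewrite addrA subrK opprB addrA subrK. Qed.

(** * Sign operators on the scale of sequence spaces *)

Section ConcreteSpaces.
Context {R : realType} (h : growth R).

Lemma inner_exists r : {d : inner (Hsp h r) | forall x y, d x y = ip h r x y}.
Proof.
by exists (Inner (symbil_ip h r) (fun x => esym (HnormE x))).
Qed.

(* [innerH] and [incl] project opaque existence proofs, so that unification
   never unfolds them. *)
Definition innerH r : inner (Hsp h r) := sval (inner_exists r).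

Lemma innerHE r x y : innerH r x y = ip h r x y.
Proof. exact: (svalP (inner_exists r)). Qed.

Lemma inclusion_exists :
  {f : 'L(Hsp h 1, Hsp h 0) | forall x, seq_of (f x) = seq_of x}.
Proof.
have bl : (fun x : Hsp h 1 => emb h 0 x) \in @bounded_linear R (Hsp h 1) (Hsp h 0).
  apply/bounded_linearP; split=> [c x y|].
    by rewrite seq_lin emb_lin//; exact: seqW.
  exists (Num.sqrt (h 0 `^ (0 - 1))) => x.
  rewrite -ler_sqr ?nnegrE ?mulr_ge0 ?sqrtr_ge0// exprMn (sqr_sqrtr (powR_ge0 _ _)).
  have [x0 xe] := wsummableW ler01 (valP x).
  by rewrite [X in _ <= _ * X]HnormE; apply: le_trans xe; rewrite -norm_emb.
by exists (MkBdop bl) => x /=; rewrite embK//; exact: seqW.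
Qed.

Definition incl : 'L(Hsp h 1, Hsp h 0) := sval inclusion_exists.

Lemma seq_incl x : seq_of (incl x) = seq_of x.
Proof. exact: (svalP inclusion_exists). Qed.

Lemma emb_incl (x : Hsp h 1) : emb h 0 x = incl x.
Proof. by apply: seq_inj; rewrite seq_incl embK//; exact: seqW. Qed.

Lemma incl_inj : injective incl.
Proof. by move=> x y /(congr1 (@seq_of _ _ _)); rewrite !seq_incl => /seq_inj. Qed.

Lemma incl_compact (f : nat -> Hsp h 1) M : (forall n, `|f n| <= M) ->
  exists (G : set_system nat) (z : Hsp h 0),
    [/\ ProperFilter G, \oo `<=` G & incl (f n) @[n --> G] --> z].
Proof.
move=> fM; have [G [z [PG oG fz]]] := compact_inclusion fM.
exists G, z; split=> //; rewrite (_ : (fun n => _) = (fun n => emb h 0 (f n)))//.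
by apply/funext => n; rewrite emb_incl.
Qed.

Lemma norm_incl x : `|incl x| = nrm h 0 x.
Proof. by rewrite -nrmE seq_incl. Qed.

Definition sadj := selfadjoint (innerH 0) incl.

Definition sgnH (A : sadj) : 'L(Hsp h 0, Hsp h 0) := sgn incl_inj incl_compact A.

Definition sgn1H (A : sadj) : Hsp h 1 -> Hsp h 1 := sgn1 incl_inj incl_compact A.

Definition energyH (A : sadj) : Hsp h 1 -> R := energy incl_inj incl_compact A.

(** The comparison operator is |A|: the H_(1/2) pairing of x with |A| y is at most |x|_1 times the
    H_0 norm of |A| y, hence at most t |A x| |A y|. *)
Lemma heinz_lower (A : sadj) t : 0 <= t -> (forall x, `|x| <= t * `|A x|) ->
  forall x : Hsp h 1, ip h 2^-1 x x <= t * energyH A x.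
Proof.
move=> t0 xA; have h1 : 2^-1 <= 1 :> R by lra.
have w0 : 0 <= h 0 `^ (2^-1 - 1) by exact: powR_ge0.
apply: (@form_le_energy _ _ _ _ _ incl_inj incl_compact A
  (fun x y : Hsp h 1 => ip h 2^-1 x y) (h 0 `^ (2^-1 - 1)) t) => //.
- split=> [x y|c x y z]; first exact: ipC.
  by rewrite seq_lin ip_lin//; exact: seqW.
- move=> x y; have [xh xl] := wsummableW h1 (valP x).
  have [yh yl] := wsummableW h1 (valP y).
  apply: le_of_sqr; first by rewrite !mulr_ge0.
  rewrite real_normK ?num_real//.
  have e : 2^-1 + 2^-1 = 2 * 2^-1 :> R by ring.
  apply: le_trans (ip_mixed_CS e xh yh) _; rewrite !exprMn.
  have -> : (h 0 `^ (2^-1 - 1)) ^+ 2 * (`|x| ^+ 2 * `|y| ^+ 2) =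
    (h 0 `^ (2^-1 - 1) * `|x| ^+ 2) * (h 0 `^ (2^-1 - 1) * `|y| ^+ 2) by ring.
  rewrite !HnormE; apply: ler_pM => //; exact: ip_sqr_ge0.
- move=> x y y' yy'; apply: le_of_sqr; first by rewrite !mulr_ge0.
  have y0 : seq_of y' \in wsummable h 0 by exact: (seqW _ ler01).
  have e : 1 + 0 = 2 * 2^-1 :> R by field.
  apply: le_trans (ip_mixed_CS e (valP x) y0) _.
  rewrite mulrA exprMn.
  have -> : ip h 0 y' y' = `|A y| ^+ 2.
    rewrite -(norm_sgn incl_inj incl_compact A (A y)) -yy' norm_incl.
    by rewrite nrm_sqr.
  rewrite ler_wpM2r ?sqr_ge0// -HnormE.
  by rewrite ler_sqr ?nnegrE ?mulr_ge0.
Qed.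

(** The roles are exchanged: the energy is the form Q and multiplication by h^(1/2) is the
    comparison operator, which confines the statement to truncations. *)
Lemma heinz_upper (A : sadj) t : 0 <= t -> (forall x, `|A x| <= t * `|x|) ->
  forall N (x : nat -> R), energyH A (emb h 1 (trunc N x)) <= t * psum h 2^-1 x x N.
Proof.
move=> t0 Ax N; pose X x := emb h 1 (trunc N x).
pose Q x y := innerH 0 (sgnH A (A (X x))) (incl (X y)).
have Xlin c u v : X (c *: u + v) = c *: X u + X v.
  by rewrite /X trunc_lin emb_lin// trunc_wsummable.
have Qb : symbil Q.
  split=> [u v|c u v w]; first by rewrite /Q abs_sym dotC.
  by rewrite /Q Xlin !bdopD !bdopZ dotDl.
have QN u v : Q u v <= `|A (X u)| * `|incl (X v)|.
  apply: le_trans (ler_norm _) _; apply: le_trans (dot_CS _ _ _) _.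
  by rewrite norm_sgn.
have XN u : `|X u| = Num.sqrt (psum h 1 u u N).
  by rewrite /X nrm_emb ?trunc_wsummable// /nrm ip_trunc.
have XN2 u : `|X u| ^+ 2 = psum h 1 u u N.
  by rewrite XN sqr_sqrtr// psum_ge0.
have o0 := opnorm_ge0 incl.
have := @finseq_comparison R h 0 t (t * opnorm incl) N Q Qb t0 (mulr_ge0 t0 o0).
rewrite !add0r; apply=> u.
- rewrite -XN2 ger0_norm; last exact: energy_ge0.
  apply: le_trans (QN u u) _; rewrite expr2 mulrACA.
  by apply: ler_pM => //; exact: opnorm_le.
- rewrite -XN2; apply: le_trans (QN _ _) _; rewrite expr2 mulrA.
  apply: ler_pM => //.
  rewrite norm_incl embK ?trunc_wsummable// XN /nrm ip_trunc.
  rewrite le_eqVlt; apply/orP; left; apply/eqP; congr Num.sqrt.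
  by apply: eq_bigr => i _; have := weight_half h 0 i; rewrite add0r => ->; ring.
Qed.

(** One constant for A and its inverse on both levels of the scale; the Lipschitz constants below
    are polynomials in it. *)
Record bounds (A : sadj) (t : R) : Prop := Bounds {
  bounds_ge0 : 0 <= t;
  bounds_lower : forall x, `|x| <= t * `|A x|;
  bounds_upper : forall x, `|A x| <= t * `|x|;
  bounds_op : maps 2 1 t A;
  bounds_inv : maps 1 2 t (sa_inv A) }.

Lemma boundsW A s t : t <= s -> bounds A t -> bounds A s.
Proof.
move=> ts [t0 lo up op inv]; split.
- exact: le_trans t0 ts.
- by move=> x; exact: le_trans (lo x) (ler_wpM2r (normr_ge0 _) ts).
- by move=> x; exact: le_trans (up x) (ler_wpM2r (normr_ge0 _) ts).
- exact: mapsW ts op.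
- exact: mapsW ts inv.
Qed.

Let e32 : 3 / 2 = 1 + 2^-1 :> R. Proof. by field. Qed.
Let e12 : 2^-1 = 0 + 2^-1 :> R. Proof. by rewrite add0r. Qed.
Let e2 : 2 = 1 + 1 :> R. Proof. by ring. Qed.
Let e1 : 1 = 0 + 1 :> R. Proof. by rewrite add0r. Qed.

Lemma maps_half (E : 'L(Hsp h 1, Hsp h 0)) d : 0 <= d ->
  (forall x, `|E x| <= d * `|x|) -> maps 2 1 d E -> maps (3 / 2) 2^-1 d E.
Proof.
move=> d0 Ed Ed2.
have E0 : maps 1 0 d E by move=> x _; split; [exact: valP|exact: Ed].
exact: (maps_interpolation d0 e2 e32 e1 e12 E0 Ed2).
Qed.

Lemma bounds_op_half A t : bounds A t -> maps (3 / 2) 2^-1 t A.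
Proof. by move=> [t0 _ up op _]; exact: maps_half t0 up op. Qed.

Lemma bounds_inv_half A t : bounds A t -> maps 2^-1 (3 / 2) t (sa_inv A).
Proof.
move=> [t0 lo _ _ inv].
have inv0 : maps 0 1 t (sa_inv A).
  by move=> x _; split; [exact: valP|have := lo (sa_inv A x); rewrite sa_invK].
exact: (maps_interpolation t0 e1 e12 e2 e32 inv0 inv).
Qed.

Lemma sgnH_incl A x : sgnH A (incl x) = incl (sgn1H A x).
Proof. by rewrite /sgn1H inc_sgn1. Qed.

Lemma emb_trunc N (x : nat -> R) : emb h 0 (trunc N x) = incl (emb h 1 (trunc N x)).
Proof. by apply: seq_inj; rewrite seq_incl !embK// trunc_wsummable. Qed.

Lemma seq_half (x : Hsp h 1) : seq_of x \in wsummable h 2^-1.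
Proof. by apply: seqW; lra. Qed.

(** The sign preserves the energy, and the two Heinz inequalities compare the energy with the
    squared H_(1/2) norm at a cost of t each. *)
Lemma sgn_half A t : bounds A t -> maps 2^-1 2^-1 t (sgnH A).
Proof.
move=> [t0 lo up _ _]; apply: maps_trunc => // N x.
rewrite emb_trunc sgnH_incl seq_incl; set y := sgn1H A _.
have yh := seq_half y; split=> //.
rewrite nrm_le ?mulr_ge0 ?nrm_ge0// exprMn nrm_sqr ?trunc_wsummable// ip_trunc.
apply: le_trans (heinz_lower t0 lo y) _.
rewrite /y /energyH energy_sgn1 expr2 -mulrA ler_wpM2l//.
exact: heinz_upper.
Qed.

Lemma emb1_incl (u : Hsp h 0) : seq_of u \in wsummable h (3 / 2) ->
  u = incl (emb h 1 u).
Proof.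
move=> us; have h1 : 1 <= 3 / 2 :> R by lra.
have [u1 _] := wsummableW h1 us.
by apply: seq_inj; rewrite seq_incl (embK u1).
Qed.

Lemma maps_incl (f : 'L(Hsp h 0, Hsp h 0)) C :
  (forall x : Hsp h 1, seq_of x \in wsummable h (3 / 2) ->
    seq_of (f (incl x)) \in wsummable h (3 / 2) /\
    nrm h (3 / 2) (f (incl x)) <= C * nrm h (3 / 2) x) ->
  maps (3 / 2) (3 / 2) C f.
Proof.
move=> H u us; have e := emb1_incl us.
have ex : seq_of (emb h 1 u) = u by rewrite -seq_incl -e.
by have := H (emb h 1 u); rewrite ex -e; apply.
Qed.

Lemma sgn_three_halves A t : bounds A t -> maps (3 / 2) (3 / 2) (t ^+ 3) (sgnH A).
Proof.
move=> bA; apply: maps_incl => x us; rewrite sgnH_incl !seq_incl.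
have [a1 a2] := bounds_op_half bA us.
have [b1 b2] := sgn_half bA a1.
have [c1 c2] := bounds_inv_half bA b1; split=> //.
have t0 := bounds_ge0 bA.
apply: le_trans c2 _; rewrite exprS -mulrA ler_wpM2l//; apply: le_trans b2 _.
by rewrite expr2 -mulrA ler_wpM2l.
Qed.

Section Difference.
Variables (A B : sadj) (t d : R) (E : 'L(Hsp h 1, Hsp h 0)) (D : 'L(Hsp h 0, Hsp h 0)).
Hypotheses (bA : bounds A t) (bB : bounds B t) (d0 : 0 <= d)
  (EE : forall x, E x = B x - A x) (DE : forall u, D u = sgnH B u - sgnH A u)
  (Ed : forall x, `|E x| <= d * `|x|) (Ed2 : maps 2 1 d E).

Lemma sgn1_difference x : D (incl x) = incl (sgn1H B x - sgn1H A x).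
Proof. by rewrite DE bdopB !sgnH_incl. Qed.

(** For squared norms the factors are t from [heinz_lower] for B, (d t)^2 from the Lyapunov estimate
    and t from [heinz_upper] for A, with product (d t^2)^2. *)
Lemma sgn_half_difference : maps 2^-1 2^-1 (d * t ^+ 2) D.
Proof.
have [t0 loA upA _ _] := bA; have [_ loB upB _ _] := bB.
have BA x : `|B x - A x| <= d * `|x| by rewrite -EE.
have k0 : 0 <= d * t ^+ 2 by rewrite mulr_ge0// sqr_ge0.
apply: maps_trunc => // N x.
rewrite emb_trunc sgn1_difference seq_incl; set X := emb h 1 _.
set y := sgn1H B X - _.
have yh := seq_half y; split=> //.
rewrite nrm_le ?mulr_ge0 ?nrm_ge0 ?sqr_ge0// exprMn nrm_sqr ?trunc_wsummable// ip_trunc.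
apply: le_trans (heinz_lower t0 loB y) _.
have H : energyH B y <= (d * t) ^+ 2 * energyH A X.
  exact: (energy_sgn_difference incl_inj incl_compact d0 t0 BA loA X).
apply: le_trans (ler_wpM2l t0 H) _.
have H2 := heinz_upper t0 upA N x; rewrite -/X in H2.
apply: le_trans (ler_wpM2l t0 (ler_wpM2l (sqr_ge0 (d * t)) H2)) _.
by rewrite le_eqVlt; apply/orP; left; apply/eqP; ring.
Qed.

(** The three factors of the conjugated sign are changed one at a time; the last term is the
    resolvent identity A^-1 - B^-1 = B^-1 E A^-1. Each term passes through H_(1/2). *)
Lemma sgn1_difference_split x : sgn1H B x - sgn1H A x =
  sa_inv B (sgnH B (E x)) + sa_inv B (D (A x))
  - sa_inv B (E (sa_inv A (sgnH A (A x)))).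
Proof.
have h1 : sa_inv B (sgnH B (E x)) = sgn1H B x - sa_inv B (sgnH B (A x)).
  by rewrite EE !bdopB.
have h2 : sa_inv B (D (A x)) = sa_inv B (sgnH B (A x)) - sa_inv B (sgnH A (A x)).
  by rewrite DE; exact: bdopB.
have h3 y : sa_inv B (E (sa_inv A y)) = sa_inv A y - sa_inv B y.
  by rewrite EE !bdopB (sa_invK A) (sa_opK B).
by rewrite h1 h2 h3; exact: telescope_difference.
Qed.

(** The three terms of [sgn1_difference_split] cost d t^2, d t^4 and d t^4. *)
Lemma sgn_three_halves_difference :
  maps (3 / 2) (3 / 2) (d * (t ^+ 2 + 2 * t ^+ 4)) D.
Proof.
apply: maps_incl => x us.
have Eh := maps_half d0 Ed Ed2.
have Dh := sgn_half_difference.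
have t0 := bounds_ge0 bA.
rewrite sgn1_difference sgn1_difference_split !seq_incl.
have [E1 E2] := Eh _ us; have [p1 p2] := sgn_half bB E1.
have [p3 p4] := bounds_inv_half bB p1.
have [A1 A2] := bounds_op_half bA us; have [q1 q2] := Dh _ A1.
have [q3 q4] := bounds_inv_half bB q1.
have [s1 s2] := sgn_half bA A1; have [s3 s4] := bounds_inv_half bA s1.
have [s5 s6] := Eh _ s3; have [s7 s8] := bounds_inv_half bB s5.
move: p3 p4 q3 q4 s7 s8.
move: (sa_inv B (sgnH B (E x))) (sa_inv B (D (A x))) => p q.
move: (sa_inv B (E _)) => s p3 p4 q3 q4 s7 s8.
have pq : seq_of (p + q - s) = seq_of p + seq_of q - seq_of s by [].
have pqs : seq_of p + seq_of q \in wsummable h (3 / 2) by rewrite rpredD.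
rewrite pq; split; first by rewrite rpredB.
apply: le_trans (nrmB pqs s7) _; apply: le_trans (lerD (nrmD p3 q3) (lexx _)) _.
have n0 := nrm_ge0 h (3 / 2) x; move: (nrm h (3 / 2) x) n0 E2 A2 => n n0 E2 A2.
have P : nrm h (3 / 2) p <= t * (t * (d * n)).
  by apply: le_trans p4 _; rewrite ler_wpM2l//; apply: le_trans p2 _; rewrite ler_wpM2l.
have k0 : 0 <= d * t ^+ 2 by rewrite mulr_ge0// sqr_ge0.
have Q : nrm h (3 / 2) q <= t * (d * t ^+ 2 * (t * n)).
  by apply: le_trans q4 _; rewrite ler_wpM2l//; apply: le_trans q2 _; rewrite ler_wpM2l.
have S : nrm h (3 / 2) s <= t * (d * (t * (t * (t * n)))).
  apply: le_trans s8 _; rewrite ler_wpM2l//; apply: le_trans s6 _; rewrite ler_wpM2l//.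
  apply: le_trans s4 _; rewrite ler_wpM2l//; apply: le_trans s2 _; rewrite ler_wpM2l//.
apply: le_trans (lerD (lerD P Q) S) _.
by rewrite le_eqVlt; apply/orP; left; apply/eqP; ring.
Qed.

End Difference.

End ConcreteSpaces.

(** * Weak Hessians *)

Lemma linear_unit_bound (R : realType) (E F : normedModType R) (g : E -> F) M v :
  linear g -> (forall x, `|x| <= 1 -> `|g x| <= M) -> `|g v| <= M * `|v|.
Proof.
move=> lg gM.
have g0 : g 0 = 0.
  by have := lg (-1) 0 0; rewrite !scaleN1r oppr0 addr0 addrC subrr.
have [->|v0] := eqVneq v 0; first by rewrite g0 !normr0 mulr0.
have vp : 0 < `|v| by rewrite normr_gt0.
have w1 : `|(`|v|^-1 *: v)| <= 1 by rewrite normrZ normfV normr_id mulVf// gt_eqF.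
have := gM _ w1; have -> : g (`|v|^-1 *: v) = `|v|^-1 *: g v.
  by have := lg `|v|^-1 v 0; rewrite addr0 g0 addr0.
by rewrite normrZ normfV normr_id mulrC ler_pdivrMr.
Qed.

Section Fredholm.
Context {R : realType} {E F : normedModType R}.

Lemma has_dim0 n : has_dim [set 0 : E] n -> n = 0%N.
Proof.
move=> [e [ind dim]]; case: n e ind dim => // n e ind dim.
have e0 : e ord0 = 0.
  have : [set 0 : E] (e ord0) by rewrite dim; apply: sub_lin_span; exists ord0.
  by [].
have s0 : \sum_i (i == ord0)%:R *: e i = 0.
  rewrite big1// => i _.
  by have [->|_] := eqVneq i ord0; rewrite ?e0 ?scaler0 ?scale0r.
by have /eqP := ind _ s0 ord0; rewrite eqxx oner_eq0.
Qed.

(** A trivial kernel has dimension 0, so index zero forces codimension 0, and the complement of the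
    range is spanned by an empty family. *)
Lemma fredholm0_surjective (f : 'L(E, F)) : fredholm_of_index f 0 ->
  (forall x, f x = 0 -> x = 0) -> forall y, exists x, f x = y.
Proof.
move=> [n [m [dn _ [e [_ dm]] nm]]] f0 y.
have n0 : n = 0%N.
  apply: has_dim0; rewrite (_ : [set 0] = [set x | f x = 0])//.
  apply/seteqP; split=> x /=; first by move=> ->; exact: bdop0.
  exact: f0.
have m0 : m = 0%N by move: nm; rewrite n0 => /eqP; rewrite eq_sym sub0r oppr_eq0 => /eqP[].
subst m; have [s [c [[x _ <-] ->]]] := dm y.
by exists x; rewrite big_ord0 addr0.
Qed.

End Fredholm.

Section WeakHessianBounds.
Context {R : realType} (h : growth R).

Lemma sadj_of_floer_inv (B : LL h 1 0 2 1) : floer_inv h B ->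
  exists A : sadj h, sa_op A = B.1.
Proof.
move=> [[[_ _ Bsym _] _ _] [T [BT TB]]].
have sym x y : innerH h 0 (B.1 x) (incl h y) = innerH h 0 (incl h x) (B.1 y).
  by rewrite !innerHE !seq_incl; exact: Bsym.
by exists (SelfAdjoint BT TB sym).
Qed.

Lemma seq0 s : seq_of (0 : Hsp h s) = 0. Proof. by []. Qed.

Lemma agreeB (f f' : 'L(Hsp h 1, Hsp h 0)) (g g' : 'L(Hsp h 2, Hsp h 1)) :
  agree f g -> agree f' g' -> agree (f - f') (g - g').
Proof.
move=> fg fg' x y xy.
have fE : seq_of ((f - f') x) = seq_of (f x) - seq_of (f' x) by [].
have gE : seq_of ((g - g') y) = seq_of (g y) - seq_of (g' y) by [].
by rewrite fE gE (fg _ _ xy) (fg' _ _ xy).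
Qed.

Lemma maps_of_agree (f : 'L(Hsp h 1, Hsp h 0)) (g : 'L(Hsp h 2, Hsp h 1)) :
  agree f g -> maps 2 1 (opnorm g) f.
Proof.
move=> fg x x2; rewrite (fg _ _ (esym (embK x2))); split; first exact: valP.
by rewrite nrmE -(nrm_emb x2) opnorm_le.
Qed.

Section One.
Variables (B : LL h 1 0 2 1) (A : sadj h).
Hypotheses (hB : floer_inv h B) (AB : sa_op A = B.1).

Let agr : agree B.1 B.2. Proof. by have [[[]]] := hB. Qed.

Let op_maps21 : maps 2 1 (opnorm B.2) A.
Proof. by rewrite AB; exact: maps_of_agree. Qed.

(** Regularity of the inverse: the restriction H_2 -> H_1 inherits injectivity from A, index zero
    makes it onto, and the H_2 preimage must agree with the H_1 one. *)
Lemma inv_wsummable2 (u : Hsp h 0) : seq_of u \in wsummable h 1 ->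
  seq_of (sa_inv A u) \in wsummable h 2.
Proof.
move=> u1; have [[[_ _ _ fB] _ _] _] := hB.
have inj x : B.2 x = 0 -> x = 0.
  move=> Bx; have l12 : 1 <= 2 :> R by lra.
  have x1 : seq_of x \in wsummable h 1 by exact: seqW.
  have e : seq_of (B.1 (emb h 1 x)) = seq_of (B.2 x) by apply: agr; rewrite embK.
  have A0 : A (emb h 1 x) = 0.
    apply: seq_inj.
    rewrite AB.
    rewrite e.
    rewrite Bx.
    exact: (etrans (seq0 1) (esym (seq0 0))).
  have X0 : emb h 1 x = 0.
    rewrite -[emb h 1 x](sa_opK A).
    rewrite A0.
    exact: bdop0.
  apply: seq_inj.
  rewrite -(embK x1).
  rewrite X0.
  exact: (etrans (seq0 1) (esym (seq0 2))).
have [x Bx] := fredholm0_surjective fB inj (emb h 1 u).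
have x1 : seq_of x \in wsummable h 1 by apply: seqW; lra.
have e : seq_of (B.1 (emb h 1 x)) = seq_of (B.2 x) by apply: agr; rewrite embK.
have -> : u = A (emb h 1 x) by apply: seq_inj; rewrite AB e Bx embK.
by rewrite (sa_opK A) (embK x1); exact: valP.
Qed.

(* Uniform boundedness, applied to the truncations of [A^-1]. *)
Lemma inv_maps12 : exists C, 0 <= C /\ maps 1 2 C (sa_inv A).
Proof.
pose f N (v : Hsp h 1) : Hsp h 2 := emb h 2 (trunc N (sa_inv A (incl h v))).
have fN N v : `|f N v| ^+ 2 = psum h 2 (sa_inv A (incl h v)) (sa_inv A (incl h v)) N.
  by rewrite norm_emb ?trunc_wsummable// ip_trunc.
have lf N : linear (f N).
  move=> c x y; rewrite /f.
  have -> : seq_of (sa_inv A (incl h (c *: x + y))) =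
    c *: seq_of (sa_inv A (incl h x)) + seq_of (sa_inv A (incl h y)).
    by rewrite !linearP.
  by rewrite trunc_lin emb_lin// trunc_wsummable.
have T2 v : seq_of (sa_inv A (incl h v)) \in wsummable h 2.
  by apply: inv_wsummable2; rewrite seq_incl; exact: valP.
have pw : pointwise_bounded (range f).
  move=> v; exists (nrm h 2 (sa_inv A (incl h v))) => _ [N _ <-].
  rewrite -ler_sqr ?nnegrE ?nrm_ge0// fN nrm_sqr//.
  exact: psum_le_ip.
have yN v : `|incl h (sa_inv A (incl h v))| <=
    opnorm (incl h) * (opnorm (sa_inv A) * opnorm (incl h)) * `|v|.
  rewrite (le_trans (opnorm_le _ _))// -!mulrA ler_wpM2l ?opnorm_ge0//.
  by rewrite (le_trans (opnorm_le _ _))// ler_wpM2l ?opnorm_ge0// opnorm_le.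
(* For fixed N, h^2 <= h(N)^2 below N bounds the H_2 norm of the truncation by an H_0 norm, where
   the inverse is already bounded. *)
have bf : forall g, range f g -> bounded_fun_norm g /\ linear g.
  move=> _ [N _ <-]; split=> // r.
  set K := opnorm _ * _ in yN.
  have K0 : 0 <= K by rewrite !mulr_ge0 ?opnorm_ge0.
  have Kr : 0 <= K * `|r| by rewrite mulr_ge0.
  exists (Num.sqrt (h N `^ 2) * (K * `|r|)) => v vr.
  rewrite -ler_sqr ?nnegrE ?(mulr_ge0 (sqrtr_ge0 _) Kr)//.
  rewrite exprMn (sqr_sqrtr (powR_ge0 _ _)) fN.
  have := yN v; set y := sa_inv A (incl h v) => yK.
  have y0 : seq_of y \in wsummable h 0 by exact: seqW.
  apply: (@le_trans _ _ (h N `^ 2 * psum h 0 y y N)).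
    rewrite /psum /series /= mulr_sumr; apply: ler_sum_nat => i /= iN.
    rewrite weight0 mul1r -mulrA ler_wpM2r//; first by rewrite -expr2 sqr_ge0.
    apply: ge0_ler_powR; rewrite ?nnegrE ?(ltW (growth_gt0 _ _))//.
    exact/growth_mono/ltnW.
  rewrite ler_wpM2l ?powR_ge0//; apply: le_trans (psum_le_ip N y0) _.
  rewrite -(nrm_sqr y0) -norm_incl ler_sqr ?nnegrE//.
  by apply: le_trans yK _; rewrite ler_wpM2l// (le_trans vr)// ler_norm.
have [M MP] := Banach_Steinhauss bf pw 1.
have M0 : 0 <= M.
  have f0 : `|f 0%N 0| <= M by apply: MP; [exists 0%N|rewrite normr0].
  exact: le_trans (normr_ge0 _) f0.
have fM N v : `|f N v| <= M * `|v|.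
  by apply: linear_unit_bound => // x x1; apply: MP x1; exists N.
exists M; split; first exact: M0.
move=> u u1; split; first exact: inv_wsummable2.
have -> : u = incl h (emb h 1 u) by apply: seq_inj; rewrite seq_incl embK.
set v := emb h 1 u; rewrite seq_incl nrmE.
rewrite (nrm_le (mulr_ge0 M0 (normr_ge0 v)) (T2 v)).
suff bnd N : psum h 2 (sa_inv A (incl h v)) (sa_inv A (incl h v)) N <= (M * `|v|) ^+ 2.
  by have [] := wsummable_le bnd.
by rewrite -fN ler_sqr ?nnegrE ?(mulr_ge0 M0 (normr_ge0 v)).
Qed.

Lemma bounds_exist : exists t, bounds A t.
Proof.
have [C [C0 HC]] := inv_maps12.
pose t := C + opnorm B.2 + opnorm (sa_op A) + opnorm (sa_inv A).
have B0 := opnorm_ge0 B.2; have A0 := opnorm_ge0 (sa_op A).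
have I0 := opnorm_ge0 (sa_inv A).
exists t; split.
- by rewrite !addr_ge0.
- move=> x; rewrite -{1}[x](sa_opK A) (le_trans (opnorm_le _ _))// ler_wpM2r//.
  by rewrite /t lerDr !addr_ge0.
- move=> x; rewrite (le_trans (opnorm_le _ _))// ler_wpM2r// /t.
  by rewrite -addrA addrC -addrA lerDl !addr_ge0.
- apply: mapsW op_maps21; rewrite /t -!addrA addrCA lerDl; rewrite !addr_ge0//.
- by apply: mapsW HC; rewrite /t -!addrA lerDl !addr_ge0.
Qed.

End One.

(** The smallness of e gives t e <= 1/2, so in |x| <= t |B x| + t e |x| the last term is absorbed,
    giving the factor 2 t; the upper bounds need t + e <= t + 1. In H_2 the absorption requires the
    norm of x to be finite beforehand, which [inv_wsummable2] supplies for B. *)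
Lemma bounds_near (A B : sadj h) (a b : LL h 1 0 2 1) t e :
  floer_inv h b -> sa_op A = a.1 -> sa_op B = b.1 ->
  bounds A t -> 0 <= e -> e * (2 * t + 2) <= 1 ->
  (forall x, `|B x - A x| <= e * `|x|) -> maps 2 1 e (fun x => B x - A x) ->
  bounds B (2 * t + 1).
Proof.
move=> hb Aa Bb [t0 lo up op inv] e0 et BA BA2.
have te : t * e <= 2^-1 by nra.
have e1 : e <= 1 by nra.
split.
- by lra.
- move=> x; have h1 := lo x.
  have h2 : `|A x| <= `|B x| + e * `|x|.
    rewrite -[A x](subKr (B x)) (le_trans (ler_normB _ _))// lerD2l.
    exact: BA.
  have := normr_ge0 x; have := normr_ge0 (B x).
  move: (`|x|) (`|A x|) (`|B x|) h1 h2 => p q r h1 h2 r0 p0.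
  have h3 := ler_wpM2l t0 h2; nra.
- move=> x; have h1 := up x.
  have h2 : `|B x| <= `|A x| + e * `|x|.
    rewrite -[B x](subrK (A x)) addrC (le_trans (ler_normD _ _))// lerD2l.
    exact: BA.
  have := normr_ge0 x.
  move: (`|x|) (`|A x|) (`|B x|) h1 h2 => p q r h1 h2 p0.
  have h3 := ler_wpM2r p0 e1; nra.
- move=> x x2; have [A1 A2] := op _ x2; have [E1 E2] := BA2 _ x2.
  have -> : seq_of (B x) = seq_of (A x) + seq_of (B x - A x).
    by rewrite seqB addrC subrK.
  split; first exact: rpredD A1 E1.
  apply: le_trans (nrmD A1 E1) _; apply: le_trans (lerD A2 E2) _.
  have p0 := nrm_ge0 h 2 x; move: (nrm h 2 x) p0 => p p0.
  have h3 := ler_wpM2r p0 e1; nra.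
- move=> u u1; have x2 := inv_wsummable2 hb Bb u1; split=> //.
  set x := sa_inv B u in x2 *.
  have [A1 _] := op _ x2; have [E1 E2] := BA2 _ x2.
  have [_] := inv _ A1; rewrite (sa_opK A) => h1.
  have ex : seq_of (A x) = seq_of u - seq_of (B x - A x).
    by rewrite seqB /x (sa_invK B) subKr.
  have h2 : nrm h 1 (A x) <= nrm h 1 u + e * nrm h 2 x.
    by rewrite ex; apply: le_trans (nrmB u1 E1) _; rewrite lerD2l.
  have := nrm_ge0 h 1 u; have := nrm_ge0 h 2 x.
  move: (nrm h 2 x) (nrm h 1 (A x)) (nrm h 1 u) h1 h2 => p q r h1 h2 p0 r0.
  have h3 := ler_wpM2l t0 h2; nra.
Qed.

End WeakHessianBounds.

Lemma locally_lipschitz_within (R : realType) (E F : normedModType R) (U : set E)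
  (f : E -> F) :
  (forall a, U a -> exists e C, [/\ 0 < e, 0 <= C &
     forall b, U b -> `|b - a| <= e -> `|f b - f a| <= C * `|b - a|]) ->
  {within U, continuous f}.
Proof.
move=> H; apply/subspace_continuousP => a Ua; have [e [C [e0 C0 fC]]] := H a Ua.
apply/cvgrPdist_le => d d0; have C1 : 0 < C + 1 by lra.
have m0 : 0 < Num.min e (d / (C + 1)) by rewrite lt_min e0 divr_gt0.
have := @cvg_id _ (nbhs a); move=> /cvgrPdist_le/(_ _ m0) near_a.
rewrite near_withinE; apply: filterS near_a => b; rewrite le_min => /andP[be bd] Ub.
rewrite distrC in be; rewrite distrC in bd.
rewrite distrC; apply: le_trans (fC b Ub be) _.
move: bd; rewrite ler_pdivlMr// => bd; apply: le_trans bd.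
by rewrite mulrC ler_wpM2l// lerDl.
Qed.

Lemma scale_halfB (R : realType) (V : lmodType R) (e : R) (u p q : V) :
  2^-1 *: (u + e *: p) - 2^-1 *: (u + e *: q) = (2^-1 * e) *: (p - q).
Proof. by rewrite -scalerBr opprD addrACA subrr add0r -scalerBr scalerA. Qed.

Lemma scale_half_linear (R : realType) (V : lmodType R) (e c : R) (x y p q : V) :
  2^-1 *: (c *: x + y + e *: (c *: p + q)) =
  c *: (2^-1 *: (x + e *: p)) + 2^-1 *: (y + e *: q).
Proof.
rewrite [e *: (_ + _)]scalerDr addrACA scalerDr scalerA [e * c]mulrC -scalerA.
by rewrite -[c *: x + _]scalerDr !scalerA [2^-1 * c]mulrC.
Qed.

(** * Restriction of operators on H_0 to H_(1/2) and H_(3/2) *)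

Section Restriction.
Context {R : realType} (h : growth R).

Lemma nrmZ s c (x : nat -> R) : x \in wsummable h s ->
  nrm h s (c *: x) = `|c| * nrm h s x.
Proof.
move=> xs; have [_ e] := series_scale c xs.
by rewrite /nrm e sqrtrM ?sqr_ge0// sqrtr_sqr.
Qed.

Lemma restrict_exists (f : Hsp h 0 -> Hsp h 0) s C : 0 <= s -> linear f ->
  maps s s C f -> exists F : 'L(Hsp h s, Hsp h s), agree f F.
Proof.
move=> s0 lf fC.
have bl : (fun x : Hsp h s => emb h s (f (emb h 0 x))) \in
    @bounded_linear R (Hsp h s) (Hsp h s).
  have x0 (x : Hsp h s) : seq_of x \in wsummable h 0 by exact: seqW.
  have fs (x : Hsp h s) : seq_of (f (emb h 0 x)) \in wsummable h s /\
      nrm h s (f (emb h 0 x)) <= C * nrm h s x.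
    by have := fC (emb h 0 x); rewrite (embK (x0 x)) => /(_ (valP x)).
  apply/bounded_linearP; split.
    move=> c x y; have e : emb h 0 (c *: seq_of x + seq_of y) =
      c *: emb h 0 x + emb h 0 y by exact: emb_lin.
    rewrite seq_lin e lf seq_lin; apply: emb_lin; [exact: (fs x).1|exact: (fs y).1].
  exists C => x; rewrite nrm_emb; last exact: (fs x).1.
  exact: (fs x).2.
exists (MkBdop bl) => x y xy /=.
have xs : seq_of x \in wsummable h s by rewrite xy; exact: valP.
rewrite -xy emb_seq embK//; exact: (fC x xs).1.
Qed.

Lemma restricts_to_exists (f : Hsp h 0 -> Hsp h 0) C : linear f ->
  maps 2^-1 2^-1 C f -> maps (3 / 2) (3 / 2) C f -> exists Q, restricts_to f Q.
Proof.
move=> lf f1 f2.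
have h1 : 0 <= 2^-1 :> R by lra.
have h2 : 0 <= 3 / 2 :> R by lra.
have [F1 F1E] := restrict_exists h1 lf f1.
have [F2 F2E] := restrict_exists h2 lf f2.
by exists (F1, F2).
Qed.

Lemma restrict_opnorm (f g : Hsp h 0 -> Hsp h 0) s c (F G : 'L(Hsp h s, Hsp h s)) :
  0 <= s -> 0 <= c -> agree f F -> agree g G ->
  maps s s c (fun u => f u - g u) -> opnorm (F - G) <= c.
Proof.
move=> s0 c0 fF gG fg; apply: le_opnorm => // x.
have x0 : seq_of x \in wsummable h 0 by exact: seqW.
have [] := fg (emb h 0 x); rewrite (embK x0); first exact: valP.
have FG : (F - G) x = F x - G x by [].
have e : seq_of (f (emb h 0 x) - g (emb h 0 x)) = seq_of (F x - G x).
  by rewrite seqB (fF _ x (embK x0)) (gG _ x (embK x0)) -seqB.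
by rewrite e FG => _; rewrite !nrmE.
Qed.

(** Valid for any restrictions, hence for those chosen by [xget] in the selector. *)
Lemma restricts_to_norm (f g : Hsp h 0 -> Hsp h 0) c
    (Q Q' : LL h 2^-1 2^-1 (3 / 2) (3 / 2)) : 0 <= c ->
  restricts_to f Q -> restricts_to g Q' ->
  maps 2^-1 2^-1 c (fun u => f u - g u) ->
  maps (3 / 2) (3 / 2) c (fun u => f u - g u) -> `|Q - Q'| <= c.
Proof.
move=> c0 [f1 f2] [g1 g2] m1 m2; rewrite LL_normE ge_max; apply/andP; split.
  by apply: (restrict_opnorm _ c0 f1 g1 m1); lra.
by apply: (restrict_opnorm _ c0 f2 g2 m2); lra.
Qed.

Lemma maps_half_sum (S : 'L(Hsp h 0, Hsp h 0)) s C e (f : Hsp h 0 -> Hsp h 0) :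
  `|e| <= 1 -> (forall u, f u = 2^-1 *: (u + e *: S u)) -> 0 <= C ->
  maps s s C S -> maps s s (1 + C) f.
Proof.
move=> e1 fE C0 SC u us; have [S1 S2] := SC u us.
have E : seq_of (f u) = 2^-1 *: (seq_of u + e *: seq_of (S u)) by rewrite fE.
have eS : e *: seq_of (S u) \in wsummable h s by rewrite rpredZ.
have ueS : seq_of u + e *: seq_of (S u) \in wsummable h s by rewrite rpredD.
rewrite E; split; first by rewrite rpredZ.
have i2 : `|2^-1| = 2^-1 :> R by rewrite ger0_norm// invr_ge0.
have H := nrmD us eS; rewrite (nrmZ e S1) in H; rewrite (nrmZ _ ueS) i2.
have a0 := nrm_ge0 h s u; have b0 := nrm_ge0 h s (S u).
have eb : `|e| * nrm h s (S u) <= nrm h s (S u) by rewrite ler_piMl.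
have Ca : 0 <= C * nrm h s u by rewrite mulr_ge0.
have arith (p q r w v : R) : p <= q + v -> v <= r -> r <= w -> 0 <= q -> 0 <= w ->
  2^-1 * p <= q + w by lra.
by rewrite mulrDl mul1r; exact: arith H eb S2 a0 Ca.
Qed.

Lemma maps_half_difference (S S' D : 'L(Hsp h 0, Hsp h 0)) s c e
    (f g : Hsp h 0 -> Hsp h 0) :
  `|e| <= 1 -> (forall u, f u = 2^-1 *: (u + e *: S u)) ->
  (forall u, g u = 2^-1 *: (u + e *: S' u)) -> (forall u, D u = S u - S' u) ->
  0 <= c -> maps s s c D -> maps s s c (fun u => f u - g u).
Proof.
move=> e1 fE gE DE c0 Dc u us; have [D1 D2] := Dc u us.
have -> : f u - g u = (2^-1 * e) *: D u.
  by rewrite fE gE DE scale_halfB.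
have E : seq_of ((2^-1 * e) *: D u) = (2^-1 * e) *: seq_of (D u) by [].
rewrite E; split; first by rewrite rpredZ.
rewrite nrmZ//; apply: le_trans D2; rewrite ler_piMl ?nrm_ge0//.
have i2 : `|2^-1| = 2^-1 :> R by rewrite ger0_norm// invr_ge0.
by rewrite normrM i2; lra.
Qed.

End Restriction.

(** * Continuity of the spectral selectors *)

Section SpectralSelector.
Context {R : realType} (h : growth R).

Lemma orth_projE (V : set (Hsp h 0)) u : orth_proj V u = proj (innerH h 0) V u.
Proof.
rewrite /orth_proj /proj; congr xget; apply/seteqP; split=> p /= [Vp pv]; split=> // v Vv.
  by rewrite innerHE pv.
by have := pv v Vv; rewrite innerHE.
Qed.

Lemma spectral_spaceE (I : set R) (B : LL h 1 0 2 1) (A : sadj h) :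
  sa_op A = B.1 -> spectral_space I B = espace A I.
Proof.
move=> AB; rewrite /spectral_space /espace; congr (closure (lin_span _)).
apply/seteqP; split=> y.
  move=> [l [x [Il [x0 Bx] yx]]]; exists l, x; split=> //.
    split=> //; apply: seq_inj; rewrite AB Bx.
    by rewrite -(seq_incl x).
  by apply: seq_inj; rewrite yx seq_incl.
move=> [l [x [Il [x0 Bx] yx]]]; exists l, x; split=> //.
  split=> //; rewrite -AB Bx.
  by rewrite -[in RHS](seq_incl x).
by rewrite yx seq_incl.
Qed.

Lemma spectral_proj_pos (B : LL h 1 0 2 1) (A : sadj h) u : sa_op A = B.1 ->
  spectral_proj [set l | 0 < l] B u = 2^-1 *: (u + 1 *: sgnH A u).
Proof.
move=> AB; rewrite /spectral_proj orth_projE (spectral_spaceE _ AB) scale1r.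
exact: (proj_pos (@incl_inj R h) (@incl_compact R h)).
Qed.

Lemma spectral_proj_neg (B : LL h 1 0 2 1) (A : sadj h) u : sa_op A = B.1 ->
  spectral_proj [set l | l < 0] B u = 2^-1 *: (u + -1 *: sgnH A u).
Proof.
move=> AB; rewrite /spectral_proj orth_projE (spectral_spaceE _ AB) scaleN1r.
exact: (proj_neg (@incl_inj R h) (@incl_compact R h)).
Qed.

Section Selector.
Variables (I : set R) (e : R).
Hypotheses (e1 : `|e| <= 1)
  (IE : forall (B : LL h 1 0 2 1) (A : sadj h) u, sa_op A = B.1 ->
    spectral_proj I B u = 2^-1 *: (u + e *: sgnH A u)).

(** Excludes the default value of the selector: the bounds on the sign provide an actual
    restriction. The pairs of [I] and [e] used are the positive half-line with 1 and the negative
    one with -1. *)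
Lemma spectral_selectorP (B : LL h 1 0 2 1) : floer_inv h B ->
  restricts_to (spectral_proj I B) (spectral_selector I B).
Proof.
move=> hB; have [A AB] := sadj_of_floer_inv hB.
have [t bA] := bounds_exist hB AB; have t0 := bounds_ge0 bA.
pose C := t + t ^+ 3; have t3 : 0 <= t ^+ 3 by rewrite exprn_ge0.
have C0 : 0 <= C by rewrite addr_ge0.
have fE u := IE u AB.
have S1 : maps 2^-1 2^-1 C (sgnH A) by apply: mapsW (sgn_half bA); rewrite lerDl.
have S2 : maps (3 / 2) (3 / 2) C (sgnH A).
  by apply: mapsW (sgn_three_halves bA); rewrite lerDr.
have lf : linear (spectral_proj I B).
  by move=> c x y; rewrite !fE bdopD bdopZ scale_half_linear.
have ex : exists Q, restricts_to (spectral_proj I B) Q.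
  apply: (restricts_to_exists lf (maps_half_sum e1 fE C0 S1)).
  exact: (maps_half_sum e1 fE C0 S2).
rewrite /spectral_selector; set P := (X in xget _ X).
exact: (@xgetPex _ 0 P ex).
Qed.

Lemma spectral_selector_lipschitz (a : LL h 1 0 2 1) : floer_inv h a ->
  exists r C, [/\ 0 < r, 0 <= C & forall b, floer_inv h b -> `|b - a| <= r ->
    `|spectral_selector I b - spectral_selector I a| <= C * `|b - a|].
Proof.
move=> ha; have [A Aa] := sadj_of_floer_inv ha.
have [t bA] := bounds_exist ha Aa; have t0 := bounds_ge0 bA.
pose s := 2 * t + 1.
have s0 : 0 <= s by rewrite /s; lra.
pose C := s ^+ 2 + (s ^+ 2 + 2 * s ^+ 4).
have s2 : 0 <= s ^+ 2 by rewrite exprn_ge0.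
have s4 : 0 <= s ^+ 4 by rewrite exprn_ge0.
have C0 : 0 <= C by rewrite /C; lra.
have r0 : 0 < 2 * t + 2 by lra.
(* This radius is the smallness condition of [bounds_near], so s = 2 t + 1 serves A and every nearby
   B; C adds up the constants for H_(1/2) and H_(3/2) and depends on a alone. *)
exists (2 * t + 2)^-1, C; split=> //; first by rewrite invr_gt0.
move=> b hb; have [B Bb] := sadj_of_floer_inv hb.
pose d := `|b - a| => dr.
have d0 : 0 <= d by exact: normr_ge0.
have [ba1 ba2] : opnorm (b.1 - a.1) <= d /\ opnorm (b.2 - a.2) <= d.
  by apply/andP; rewrite -ge_max; exact: lexx.
have EE x : (b.1 - a.1) x = B x - A x by rewrite Aa Bb.
have Ed x : `|(b.1 - a.1) x| <= d * `|x|.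
  by apply: le_trans (opnorm_le _ _) (ler_wpM2r (normr_ge0 x) ba1).
have agr (c : LL h 1 0 2 1) : floer_inv h c -> agree c.1 c.2 by move=> [[[]]].
have Ed2 : maps 2 1 d (b.1 - a.1).
  exact: mapsW ba2 (maps_of_agree (agreeB (agr b hb) (agr a ha))).
have bB : bounds B s.
  apply: (bounds_near hb Aa Bb bA d0).
  - by rewrite -ler_pdivlMr// mul1r.
  - by move=> x; rewrite -EE.
  - by move=> x; rewrite -EE; exact: Ed2.
have {}bA : bounds A s.
  by apply: boundsW bA; rewrite /s; lra.
pose D := sgnH B - sgnH A.
have DE u : D u = sgnH B u - sgnH A u by [].
have D1 := sgn_half_difference bA bB d0 EE DE Ed.
have D2 := sgn_three_halves_difference bA bB d0 EE DE Ed Ed2.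
have Cd0 : 0 <= C * d by rewrite mulr_ge0.
have {}D1 : maps 2^-1 2^-1 (C * d) D.
  by apply: mapsW D1; rewrite mulrC ler_wpM2r// /C; lra.
have {}D2 : maps (3 / 2) (3 / 2) (C * d) D.
  by apply: mapsW D2; rewrite mulrC ler_wpM2r// /C; lra.
have fE u := IE u Bb; have gE u := IE u Aa.
apply: (restricts_to_norm Cd0 (spectral_selectorP hb) (spectral_selectorP ha)).
  exact: (maps_half_difference e1 fE gE DE Cd0 D1).
exact: (maps_half_difference e1 fE gE DE Cd0 D2).
Qed.

End Selector.

End SpectralSelector.

Theorem theoremB (R : realType) (h : growth R) (A : LL h 1 0 2 1)
    (hA : floer_inv h A) :
  exists U : set (LL h 1 0 2 1),
    [/\ U A,
        (exists V : set (LL h 1 0 2 1), open V /\ U = floer_inv h `&` V),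
        (forall B, U B ->
           restricts_to (spectral_proj [set l | 0 < l] B) (Pi_plus h B) /\
           restricts_to (spectral_proj [set l | l < 0] B) (Pi_minus h B)),
        {within U, continuous (Pi_plus h)} &
        {within U, continuous (Pi_minus h)}].
Proof.
have e1 : `|1| <= 1 :> R by rewrite normr1.
have eN1 : `|-1| <= 1 :> R by rewrite normrN1.
exists (floer_inv h); split=> //.
- by exists setT; split; [exact: openT|rewrite setIT].
- move=> B hB; split.
    exact: (spectral_selectorP e1 (@spectral_proj_pos R h) hB).
  exact: (spectral_selectorP eN1 (@spectral_proj_neg R h) hB).
- apply: locally_lipschitz_within => a ha.
  exact: (spectral_selector_lipschitz e1 (@spectral_proj_pos R h) ha).
- apply: locally_lipschitz_within => a ha.
  exact: (spectral_selector_lipschitz eN1 (@spectral_proj_neg R h) ha).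
Qed.
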